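(* Let $q$ be a complex number with $0<|q|<1$. Define $R(q) = \dfrac{(q,q^4;q^5)_\infty}{(q^2,q^3;q^5)_\infty}$ and $R_m := R(q^m)$ for positive integers $m$. Then \[ \frac{(R_2-R_1^2)(R_8-R_1^2R_2R_4)}{(R_2-R_1^2)(R_8+R_4^2)+R_2^3(R_2+R_1^2)^2} = q^2R_1^2R_8, \] and \[ \frac{(R_2-R_1^2)^3(R_4-R_2^2)(R_{16}-R_1^2R_2R_4R_8)}{(R_2-R_1^2)^3(R_4-R_2^2)(R_{16}+R_8^2)+Q(R_1,R_2,R_4)} =q^4R_1^2R_2R_{16}, \] where \[ Q(a,b,c):=a^2b^6(b+a^2)^4(c-b^2)+c^3(c+b^2)^2(b-a^2)^3. \]
   Context: For complex $a,q$ with $|q|<1$, $(a;q)_\infty := \prod_{n=0}^\infty (1-aq^n)$ and $(a_1,\ldots,a_m;q)_\infty := (a_1;q)_\infty\cdots(a_m;q)_\infty$. The function $R(q)$ is the Rogers–Ramanujan continued fraction $\frac{1}{1+\frac{q}{1+\frac{q^2}{1+\cdots}}}$, which equals the stated infinite product. The identities may equivalently be read as identities of formal power series in $q$. *)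

(* Defs.v *)
From Stdlib Require Import Reals.
From Coquelicot Require Import Coquelicot.

Open Scope C_scope.

(* (a;q)_n, the product of the n factors 1 - a q^k with 0 <= k < n *)
Fixpoint qpoch_fin (a q : C) (n : nat) : C :=
  match n with
  | O => 1
  | S k => qpoch_fin a q k * (1 - a * q ^ k)
  end.

(* (a;q)_oo.  Coquelicot's iota picks the unique l satisfying the predicate, so
   this is the limit of the partial products whenever that limit exists (which
   is always the case for |q| < 1) and an unspecified value otherwise. *)
Definition qpoch (a q : C) : C :=
  iota (T := C_CompleteNormedModule)
    (fun l : C => filterlim (qpoch_fin a q) eventually (locally l)).

Lemma qpoch_unique (a q l : C) :
  filterlim (qpoch_fin a q) eventually (locally l) -> qpoch a q = l.
Proof.
intros H.
apply (iota_filterlim_locally (V := C_CompleteNormedModule)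
         (F := eventually) (qpoch_fin a q) l).
exact H.
Qed.

Definition RR (q : C) : C :=
  (qpoch q (q ^ 5) * qpoch (q ^ 4) (q ^ 5))
  / (qpoch (q ^ 2) (q ^ 5) * qpoch (q ^ 3) (q ^ 5)).

Definition RRm (q : C) (m : nat) : C := RR (q ^ m).

Definition Qpoly (a b c : C) : C :=
  a ^ 2 * b ^ 6 * (b + a ^ 2) ^ 4 * (c - b ^ 2)
  + c ^ 3 * (c + b ^ 2) ^ 2 * (b - a ^ 2) ^ 3.

(* Main.v *)
Require Import Defs.
From Stdlib Require Import Reals Lra Lia ZArith List Permutation.
From Coquelicot Require Import Coquelicot.

Open Scope C_scope.

(* Write [u = R(q)], [v = R(q^2)], [w = R(q^4)].  Two relations suffice:

     v - u^2 = q u v^2 (v + u^2)       (Rogers),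
     w - u^2 v = q u w (w + v^2).

   By the first one, at [q] and at [q^2], the terms [R2^3 (R2 + R1^2)^2] and
   [Q(R1, R2, R4)] become rational in the [R_m] with factors [R2 - R1^2] and
   [R4 - R2^2]; what is left of the two identities is the second relation at
   [q^2] and at [q^4].

   With [theta(a) = (a, p/a; p)_oo] and [p = q^10] or [q^20], both relations
   come from three instances of the Weierstrass three-term relation.  The
   latter follows from the Jacobi triple product: splitting the double series
   of [theta(a) theta(b)] by the parity of [m + n] writes it as a 2x2
   determinant in functions of [ab] and [a/b]. *)

(** * Limits and sums of complex sequences *)

(** With x = q u v^2 the first relation reads v (1 - x) = u^2 (1 + x). Two of the Weierstrass
    instances serve to turn 1 + x and 1 - x into quotients of theta products at p = q^10, after
    which both sides are the same product. The third, at p = q^20, does this for u v + q w^2. The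
    obstacle is the rearrangement of a double series. No infinite sum over pairs is formed: the
    splitting by parity is an equality of finite index sets, a square against two diamonds, and a
    diamond is exactly the index set of a truncated Cauchy product. The triple product likewise
    starts from a finite identity, and Tannery's theorem then justifies the passage to the limit. *)

Definition clim (u : nat -> C) (l : C) : Prop :=
  is_lim_seq (fun n => Cmod (u n - l)) 0.

(** Measuring convergence by a real sequence of moduli makes squeezing and real limit arithmetic
    available; this is the bridge back to the filters in which [qpoch] is defined. *)
Lemma clim_filterlim (u : nat -> C) (l : C) :
  clim u l <->
  filterlim u eventually (locally (T := C_CompleteNormedModule) l).
Proof.
unfold clim; rewrite <- is_lim_seq_spec.
rewrite (filterlim_locally_ball_norm (U := C_NormedModule)).
split; intros H eps; destruct (H eps) as [N HN]; exists N; intros n Hn;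
  specialize (HN n Hn); simpl in HN |- *.
- unfold ball_norm; simpl.
  rewrite Rminus_0_r, Rabs_pos_eq in HN by apply Cmod_ge_0; exact HN.
- rewrite Rminus_0_r, Rabs_pos_eq by apply Cmod_ge_0; exact HN.
Qed.

Lemma is_lim_seq_0_le (u v : nat -> R) :
  (forall n, 0 <= u n <= v n)%R -> is_lim_seq v 0 -> is_lim_seq u 0.
Proof.
intros H Hv.
apply (is_lim_seq_le_le (fun _ => 0%R) u v); auto.
apply is_lim_seq_const.
Qed.

Lemma clim_ext (u v : nat -> C) (l : C) :
  (forall n, u n = v n) -> clim u l -> clim v l.
Proof.
intros H; apply is_lim_seq_ext; intros n; now rewrite H.
Qed.

Lemma clim_const (l : C) : clim (fun _ => l) l.
Proof.
apply is_lim_seq_ext with (fun _ => 0%R); [|apply is_lim_seq_const].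
intros _; replace (l - l) with (RtoC 0) by ring; now rewrite Cmod_0.
Qed.

Lemma clim_unique (u : nat -> C) (l m : C) : clim u l -> clim u m -> l = m.
Proof.
intros Hl Hm.
apply clim_filterlim in Hl; apply clim_filterlim in Hm.
transitivity (iota (T := C_CompleteNormedModule)
  (fun x => filterlim u eventually (locally x))).
- symmetry; now apply (iota_filterlim_locally (V := C_CompleteNormedModule)).
- now apply (iota_filterlim_locally (V := C_CompleteNormedModule)).
Qed.

Lemma clim_plus (u v : nat -> C) (l m : C) :
  clim u l -> clim v m -> clim (fun n => u n + v n) (l + m).
Proof.
intros Hu Hv.
apply is_lim_seq_0_le with (fun n => Cmod (u n - l) + Cmod (v n - m))%R.
- intros n; split; [apply Cmod_ge_0|].
  replace (u n + v n - (l + m)) with ((u n - l) + (v n - m)) by ring.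
  apply Cmod_triangle.
- replace (Finite 0) with (Finite (0 + 0)) by (f_equal; ring).
  now apply is_lim_seq_plus'.
Qed.

Lemma clim_Cmod (u : nat -> C) (l : C) :
  clim u l -> is_lim_seq (fun n => Cmod (u n)) (Cmod l).
Proof.
intros H; apply is_lim_seq_spec; intros eps.
apply is_lim_seq_spec in H; destruct (H eps) as [N HN]; exists N.
intros n Hn; specialize (HN n Hn).
rewrite Rminus_0_r, Rabs_pos_eq in HN by apply Cmod_ge_0.
pose proof (Cmod_triangle (u n - l) l) as H1.
pose proof (Cmod_triangle (l - u n) (u n)) as H2.
replace (u n - l + l) with (u n) in H1 by ring.
replace (l - u n + u n) with l in H2 by ring.
replace (l - u n) with (- (u n - l)) in H2 by ring.
rewrite Cmod_opp in H2.
apply Rabs_def1; lra.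
Qed.

Lemma clim_mult (u v : nat -> C) (l m : C) :
  clim u l -> clim v m -> clim (fun n => u n * v n) (l * m).
Proof.
intros Hu Hv.
apply is_lim_seq_0_le with
  (fun n => Cmod (u n) * Cmod (v n - m) + Cmod (u n - l) * Cmod m)%R.
- intros n; split; [apply Cmod_ge_0|].
  replace (u n * v n - l * m) with (u n * (v n - m) + (u n - l) * m) by ring.
  rewrite <- !Cmod_mult; apply Cmod_triangle.
- replace (Finite 0) with (Finite (Cmod l * 0 + 0 * Cmod m))
    by (f_equal; ring).
  apply is_lim_seq_plus'; apply is_lim_seq_mult'; auto using clim_Cmod;
    apply is_lim_seq_const.
Qed.

Lemma clim_scal (c : C) (u : nat -> C) (l : C) :
  clim u l -> clim (fun n => c * u n) (c * l).
Proof. apply clim_mult, clim_const. Qed.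

Lemma clim_inv (u : nat -> C) (l : C) :
  l <> 0 -> (forall n, u n <> 0) -> clim u l -> clim (fun n => / u n) (/ l).
Proof.
intros Hl Hu H.
assert (Hm : (0 < Cmod l)%R) by now apply Cmod_gt_0.
apply is_lim_seq_ext with
  (fun n => Cmod (u n - l) * (/ Cmod (u n) * / Cmod l))%R.
- intros n.
  replace (/ u n - / l) with (- (u n - l) * (/ u n * / l)) by (field; auto).
  rewrite !Cmod_mult, !Cmod_inv, Cmod_opp; auto.
- replace (Finite 0) with (Finite (0 * (/ Cmod l * / Cmod l)))
    by (f_equal; ring).
  apply is_lim_seq_mult'; [exact H|].
  apply is_lim_seq_mult'; [|apply is_lim_seq_const].
  apply (is_lim_seq_inv _ (Cmod l)); [now apply clim_Cmod|].
  intros E; inversion E; lra.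
Qed.

Lemma clim_subseq (u : nat -> C) (l : C) (f : nat -> nat) :
  (forall n, (n <= f n)%nat) -> clim u l -> clim (fun n => u (f n)) l.
Proof.
intros Hf H; unfold clim.
apply (is_lim_seq_subseq (fun n => Cmod (u n - l)) _ f); [|exact H].
intros P [N HN]; exists N; intros n Hn; apply HN; specialize (Hf n); lia.
Qed.

Lemma clim_unsubseq (u : nat -> C) (l : C) (k : nat) :
  clim (fun n => u (n + k)%nat) l -> clim u l.
Proof.
unfold clim; intros H.
apply (is_lim_seq_incr_n (fun n => Cmod (u n - l)) k); exact H.
Qed.

Lemma clim_delay (u : nat -> C) (l : C) (k : nat) :
  clim u l -> clim (fun n => u (n - k)%nat) l.
Proof.
intros H; apply clim_unsubseq with k.
apply clim_ext with u; [|exact H]; intros n; f_equal; lia.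
Qed.

(** * Finite sums and Tannery's theorem *)

Fixpoint csum (u : nat -> C) (n : nat) : C :=
  match n with O => 0 | S k => csum u k + u k end.

Fixpoint rsum (u : nat -> R) (n : nat) : R :=
  match n with O => 0%R | S k => (rsum u k + u k)%R end.

Lemma csum_ext (u v : nat -> C) (n : nat) :
  (forall k, (k < n)%nat -> u k = v k) -> csum u n = csum v n.
Proof.
induction n as [|n IH]; intros H; simpl; [easy|].
rewrite IH, H; auto with arith.
Qed.

Lemma csum_plus (u v : nat -> C) (n : nat) :
  csum (fun k => u k + v k) n = csum u n + csum v n.
Proof. induction n as [|n IH]; simpl; [|rewrite IH]; ring. Qed.

Lemma csum_scal (c : C) (u : nat -> C) (n : nat) :
  csum (fun k => c * u k) n = c * csum u n.
Proof. induction n as [|n IH]; simpl; [|rewrite IH]; ring. Qed.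

Lemma csum_triangle (u : nat -> C) (n : nat) :
  (Cmod (csum u n) <= rsum (fun k => Cmod (u k)) n)%R.
Proof.
induction n as [|n IH]; simpl; [rewrite Cmod_0; lra|].
eapply Rle_trans; [apply Cmod_triangle|lra].
Qed.

Lemma csum_sum_n (u : nat -> C) (n : nat) :
  sum_n (G := C_AbelianGroup) u n = csum u (S n).
Proof.
induction n as [|n IH].
- rewrite sum_O; simpl; ring.
- rewrite sum_Sn, IH; reflexivity.
Qed.

Lemma rsum_sum_n (u : nat -> R) (n : nat) : sum_n u n = rsum u (S n).
Proof.
induction n as [|n IH].
- rewrite sum_O; simpl; ring.
- rewrite sum_Sn, IH; reflexivity.
Qed.

Lemma rsum_lim (u : nat -> R) :
  ex_series u -> is_lim_seq (rsum u) (Series u).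
Proof.
intros H; apply is_lim_seq_incr_1.
apply is_lim_seq_ext with (sum_n u); [intros n; apply rsum_sum_n|].
apply (Series_correct _ H).
Qed.

Lemma rsum_le_Series (u : nat -> R) (n : nat) :
  (forall k, 0 <= u k)%R -> ex_series u -> (rsum u n <= Series u)%R.
Proof.
intros H Hu.
apply (is_lim_seq_incr_compare (rsum u)); [now apply rsum_lim|].
intros k; simpl; specialize (H k); lra.
Qed.

Lemma csum_abs_cv (u : nat -> C) :
  ex_series (fun k => Cmod (u k)) -> exists l, clim (csum u) l.
Proof.
intros H.
destruct (ex_series_le (V := C_CompleteNormedModule) u _
            (fun n => Rle_refl _) H) as [l Hl].
exists l; apply clim_unsubseq with 1%nat; apply clim_filterlim.
apply filterlim_ext with (sum_n (G := C_AbelianGroup) u); [|exact Hl].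
intros n; rewrite csum_sum_n; f_equal; lia.
Qed.

(** Past a suitable K the majorant contributes less than eps/2, and the first K columns form a
    finite sum of null sequences. Row n is bounded only on k < n, the range over which it is
    summed. *)
Lemma rsum_tannery (d : nat -> nat -> R) (M : nat -> R) :
  (forall n k, (k < n)%nat -> (0 <= d n k <= M k)%R) ->
  (forall k, 0 <= M k)%R ->
  ex_series M ->
  (forall k, is_lim_seq (fun n => d n k) 0) ->
  is_lim_seq (fun n => rsum (d n) n) 0.
Proof.
intros Hd HM HS Hk; apply is_lim_seq_spec; intros eps.
assert (HL := rsum_lim M HS); apply is_lim_seq_spec in HL.
destruct (HL (pos_div_2 eps)) as [K HK]; specialize (HK K (le_n K)).
assert (HKlim : forall m, is_lim_seq (fun n => rsum (d n) m) 0).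
{ induction m as [|m IH]; simpl; [apply is_lim_seq_const|].
  replace (Finite 0) with (Finite (0 + 0)) by (f_equal; ring).
  now apply is_lim_seq_plus'. }
specialize (HKlim K); apply is_lim_seq_spec in HKlim.
destruct (HKlim (pos_div_2 eps)) as [N HN].
exists (N + K)%nat; intros n Hn; specialize (HN n ltac:(lia)).
assert (Hpos : forall m, (m <= n)%nat -> (0 <= rsum (d n) m)%R).
{ induction m as [|m IH]; intros Hm; simpl; [lra|].
  specialize (IH ltac:(lia)); specialize (Hd n m ltac:(lia)); lra. }
assert (Htail : forall m, (m + K <= n)%nat ->
  (rsum (d n) (m + K) - rsum (d n) K <= rsum M (m + K) - rsum M K)%R).
{ induction m as [|m IH]; intros Hm; simpl; [lra|].
  specialize (IH ltac:(lia)); specialize (Hd n (m + K)%nat ltac:(lia)); lra. }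
specialize (Htail (n - K)%nat ltac:(lia)).
replace (n - K + K)%nat with n in Htail by lia.
assert (HB := rsum_le_Series M n HM HS).
simpl in HK, HN |- *.
apply Rabs_def2 in HK; apply Rabs_def2 in HN.
specialize (Hpos n (le_n n)).
apply Rabs_def1; lra.
Qed.

(** The limits [s k] inherit the bound [M k], so the differences [t n k - s k] are dominated by
    [2 * M k] and [rsum_tannery] applies to them. *)
Lemma tannery (t : nat -> nat -> C) (s : nat -> C) (M : nat -> R) (l : C) :
  (forall n k, (k < n)%nat -> (Cmod (t n k) <= M k)%R) ->
  ex_series M ->
  (forall k, clim (fun n => t n k) (s k)) ->
  clim (csum s) l ->
  clim (fun n => csum (t n) n) l.
Proof.
intros Ht HM Hk Hl.
assert (Hs : forall k, (Cmod (s k) <= M k)%R).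
{ intros k.
  apply (is_lim_seq_le_loc (fun n => Cmod (t n k)) (fun _ => M k)
           (Cmod (s k)) (M k)).
  - exists (S k); intros n Hn; apply Ht; lia.
  - now apply clim_Cmod.
  - apply is_lim_seq_const. }
apply clim_ext with (fun n => csum (fun k => t n k - s k) n + csum s n).
{ intros n; rewrite <- csum_plus; apply csum_ext; intros; ring. }
replace l with (0 + l) by ring.
apply clim_plus; [|exact Hl].
apply is_lim_seq_0_le with
  (fun n => rsum (fun k => Cmod (t n k - s k)) n).
{ intros n; split; [apply Cmod_ge_0|].
  replace (csum (fun k => t n k - s k) n - 0)
    with (csum (fun k => t n k - s k) n) by ring.
  apply csum_triangle. }
apply (rsum_tannery _ (fun k => 2 * M k)%R).
- intros n k H; split; [apply Cmod_ge_0|].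
  unfold Cminus; eapply Rle_trans; [apply Cmod_triangle|].
  rewrite Cmod_opp; specialize (Ht n k H); specialize (Hs k); lra.
- intros k; specialize (Hs k); pose proof (Cmod_ge_0 (s k)); lra.
- exact (ex_series_scal_l 2%R M HM).
- exact Hk.
Qed.

(** Mertens' theorem for the truncation k + j < n: the partial sums of y are bounded by some B, and
    the terms [Cmod (x k) * B] give a summable majorant. This truncation is the one that [diamond]
    produces. *)
Lemma clim_cauchy_product (x y : nat -> C) (lx ly : C) :
  ex_series (fun k => Cmod (x k)) ->
  clim (csum x) lx -> clim (csum y) ly ->
  clim (fun n => csum (fun k => x k * csum y (n - k)) n) (lx * ly).
Proof.
intros Hx Hlx Hly.
assert (HB : exists B, forall n, (Cmod (csum y n) <= B)%R).
{ destruct (filterlim_bounded (V := C_CompleteNormedModule) (csum y))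
    as [B HB]; [|now exists B].
  exists ly; now apply clim_filterlim. }
destruct HB as [B HB].
apply tannery with (s := fun k => x k * ly) (M := fun k => (Cmod (x k) * B)%R).
- intros n k _; rewrite Cmod_mult.
  apply Rmult_le_compat_l; [apply Cmod_ge_0|apply HB].
- exact (ex_series_scal_r B _ Hx).
- intros k; apply clim_scal; now apply clim_delay.
- apply clim_ext with (fun n => csum x n * ly).
  + intros n; rewrite Cmult_comm, <- csum_scal.
    apply csum_ext; intros; ring.
  + apply clim_mult; [exact Hlx|apply clim_const].
Qed.

(** * Infinite q-shifted factorials *)

Lemma ex_series_geom_scal (c q : C) :
  (Cmod q < 1)%R -> ex_series (fun k => Cmod (c * q ^ k)).
Proof.
intros Hq.
apply ex_series_ext with (fun k => Cmod c * Cmod q ^ k)%R.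
- intros k; now rewrite Cmod_mult, Cmod_pow.
- apply (ex_series_scal_l (Cmod c) (fun k => Cmod q ^ k)%R).
  apply ex_series_geom; rewrite Rabs_pos_eq; [exact Hq|apply Cmod_ge_0].
Qed.

(** Telescoping turns the product into a series; once the partial products are bounded, its terms
    are dominated by a geometric series, which gives [qpoch_lim]. *)
Lemma qpoch_fin_csum (a q : C) (n : nat) :
  qpoch_fin a q n = 1 + csum (fun k => - qpoch_fin a q k * (a * q ^ k)) n.
Proof.
induction n as [|n IH]; cbn [csum]; [simpl; ring|].
rewrite Cplus_assoc, <- IH; cbn [qpoch_fin]; ring.
Qed.

(** Each factor satisfies |1 - z| <= 1 + |z| <= exp |z|, and the sum of the |z| is geometric. *)
Lemma qpoch_fin_bound (a q : C) :
  (Cmod q < 1)%R -> exists B, forall n, (Cmod (qpoch_fin a q n) <= B)%R.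
Proof.
intros Hq; exists (exp (Series (fun k => Cmod (a * q ^ k)))); intros n.
apply Rle_trans with (exp (rsum (fun k => Cmod (a * q ^ k)) n)).
- induction n as [|n IH]; cbn [qpoch_fin rsum].
  + rewrite Cmod_1, exp_0; lra.
  + rewrite Cmod_mult, exp_plus.
    apply Rmult_le_compat; try apply Cmod_ge_0; [exact IH|].
    unfold Cminus; eapply Rle_trans; [apply Cmod_triangle|].
    rewrite Cmod_opp, Cmod_1; apply exp_ineq1_le.
- assert (H : (rsum (fun k => Cmod (a * q ^ k)) n
               <= Series (fun k => Cmod (a * q ^ k)))%R).
  { apply rsum_le_Series; [intros; apply Cmod_ge_0|].
    now apply ex_series_geom_scal. }
  destruct H as [H|H]; [left; now apply exp_increasing|now rewrite H; right].
Qed.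

Lemma qpoch_lim (a q : C) :
  (Cmod q < 1)%R -> clim (qpoch_fin a q) (qpoch a q).
Proof.
intros Hq.
destruct (qpoch_fin_bound a q Hq) as [B HB].
destruct (csum_abs_cv (fun k => - qpoch_fin a q k * (a * q ^ k))) as [l Hl].
{ apply (ex_series_le (V := R_CompleteNormedModule) _
           (fun k => B * Cmod (a * q ^ k))%R).
  - intros k; change norm with Rabs; cbn beta.
    rewrite Rabs_pos_eq by apply Cmod_ge_0.
    rewrite Cmod_mult, Cmod_opp.
    apply Rmult_le_compat_r; [apply Cmod_ge_0|apply HB].
  - apply (ex_series_scal_l B (fun k => Cmod (a * q ^ k))).
    now apply ex_series_geom_scal. }
assert (H : clim (qpoch_fin a q) (1 + l)).
{ apply clim_ext with
    (fun n => 1 + csum (fun k => - qpoch_fin a q k * (a * q ^ k)) n).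
  - intros n; symmetry; apply qpoch_fin_csum.
  - apply clim_plus; [apply clim_const|exact Hl]. }
rewrite (qpoch_unique a q (1 + l)); [exact H|].
now apply clim_filterlim.
Qed.

Lemma qpoch_fin_shift (a q : C) (n : nat) :
  qpoch_fin a q (S n) = (1 - a) * qpoch_fin (a * q) q n.
Proof.
induction n as [|n IH]; [simpl; ring|].
change (qpoch_fin a q (S (S n)))
  with (qpoch_fin a q (S n) * (1 - a * q ^ S n)).
rewrite IH; cbn [qpoch_fin]; rewrite Cpow_S; ring.
Qed.

Lemma qpoch_shift (a q : C) :
  (Cmod q < 1)%R -> qpoch a q = (1 - a) * qpoch (a * q) q.
Proof.
intros Hq; apply clim_unique with (fun n => qpoch_fin a q (S n)).
- apply (clim_subseq (qpoch_fin a q)); [lia|now apply qpoch_lim].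
- apply clim_ext with (fun n => (1 - a) * qpoch_fin (a * q) q n).
  + intros n; now rewrite qpoch_fin_shift.
  + now apply clim_scal, qpoch_lim.
Qed.

Lemma Cmod_pow2_lt (q : C) : (Cmod q < 1)%R -> (Cmod (q ^ 2) < 1)%R.
Proof. intros Hq; rewrite Cmod_pow; pose proof (Cmod_ge_0 q); nra. Qed.

Lemma qpoch_dissect (a q : C) :
  (Cmod q < 1)%R -> qpoch a q = qpoch a (q ^ 2) * qpoch (a * q) (q ^ 2).
Proof.
intros Hq; apply clim_unique with (fun n => qpoch_fin a q (2 * n)).
- apply (clim_subseq (qpoch_fin a q) _ (fun n => (2 * n)%nat)); [lia|].
  now apply qpoch_lim.
- apply clim_ext with
    (fun n => qpoch_fin a (q ^ 2) n * qpoch_fin (a * q) (q ^ 2) n).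
  + induction n as [|n IH]; [simpl; ring|].
    replace (2 * S n)%nat with (S (S (2 * n))) by lia.
    cbn [qpoch_fin]; rewrite <- IH.
    rewrite (Cpow_S q (2 * n)), (Cpow_mult_r q 2 n); ring.
  + apply clim_mult; apply qpoch_lim, Cmod_pow2_lt, Hq.
Qed.

Lemma qpoch_sqr (a q : C) :
  (Cmod q < 1)%R -> qpoch a q * qpoch (- a) q = qpoch (a ^ 2) (q ^ 2).
Proof.
intros Hq; apply clim_unique with
  (fun n => qpoch_fin a q n * qpoch_fin (- a) q n).
- apply clim_mult; now apply qpoch_lim.
- apply clim_ext with (qpoch_fin (a ^ 2) (q ^ 2)).
  + induction n as [|n IH]; cbn [qpoch_fin]; [ring|].
    rewrite IH, <- (Cpow_mult_r q 2 n), Nat.mul_comm, Cpow_mult_r; ring.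
  + apply qpoch_lim, Cmod_pow2_lt, Hq.
Qed.

Lemma Cmod_1_minus_ge (z : C) : (1 - Cmod z <= Cmod (1 - z))%R.
Proof.
pose proof (Cmod_triangle (1 - z) z) as H.
replace (1 - z + z) with (RtoC 1) in H by ring.
rewrite Cmod_1 in H; lra.
Qed.

Lemma Cmod_mul_pow_lt (a q : C) (k : nat) :
  (Cmod q < 1)%R -> (Cmod a < 1)%R -> (Cmod (a * q ^ k) < 1)%R.
Proof.
intros Hq Ha; rewrite Cmod_mult, Cmod_pow.
assert (0 <= Cmod q ^ k <= 1)%R.
{ split; [apply pow_le, Cmod_ge_0|].
  rewrite <- (pow1 k); apply pow_incr; split; [apply Cmod_ge_0|lra]. }
pose proof (Cmod_ge_0 a); nra.
Qed.

Lemma one_minus_neq_0 (z : C) : (Cmod z < 1)%R -> 1 - z <> 0.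
Proof.
intros Hz E; pose proof (Cmod_1_minus_ge z) as H.
rewrite E, Cmod_0 in H; lra.
Qed.

Lemma qpoch_fin_neq_0 (a q : C) (n : nat) :
  (Cmod q < 1)%R -> (Cmod a < 1)%R -> qpoch_fin a q n <> 0.
Proof.
intros Hq Ha; induction n as [|n IH]; cbn [qpoch_fin].
- apply C1_nz.
- apply Cmult_neq_0; [exact IH|].
  now apply one_minus_neq_0, Cmod_mul_pow_lt.
Qed.

(** The modulus of a product of factors 1 - z_k is at least 1 minus the sum of the |z_k|. Here that
    sum is at most |a| / (1 - |q|), so the bound on a keeps every partial product at modulus at
    least 1/2, and hence the limit too. *)
Lemma qpoch_neq_0_small (a q : C) :
  (Cmod q < 1)%R -> (Cmod a <= (1 - Cmod q) / 2)%R -> qpoch a q <> 0.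
Proof.
intros Hq Ha E.
assert (Hb : forall n, (Cmod a * rsum (fun k => Cmod q ^ k) n <= / 2)%R).
{ intros n.
  assert (Hg : (rsum (fun k => Cmod q ^ k) n * (1 - Cmod q)
                = 1 - Cmod q ^ n)%R)
    by (induction n as [|n IH]; simpl; lra).
  pose proof (pow_le (Cmod q) n (Cmod_ge_0 q)).
  assert (0 <= rsum (fun k => Cmod q ^ k) n)%R.
  { clear; induction n as [|n IH]; simpl; [lra|].
    pose proof (pow_le (Cmod q) n (Cmod_ge_0 q)); lra. }
  apply Rle_trans with
    ((1 - Cmod q) / 2 * rsum (fun k => Cmod q ^ k) n)%R; [|lra].
  now apply Rmult_le_compat_r. }
assert (H : forall n, (/ 2 <= 1 - Cmod a * rsum (fun k => Cmod q ^ k) n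
                      <= Cmod (qpoch_fin a q n))%R).
{ intros n; split; [specialize (Hb n); lra|].
  induction n as [|n IH]; cbn [rsum qpoch_fin]; [rewrite Cmod_1; lra|].
  rewrite Cmod_mult.
  pose proof (Cmod_1_minus_ge (a * q ^ n)) as H1.
  rewrite Cmod_mult, Cmod_pow in H1.
  specialize (Hb n).
  assert (0 <= Cmod a * rsum (fun k => Cmod q ^ k) n)%R.
  { apply Rmult_le_pos; [apply Cmod_ge_0|].
    clear; induction n as [|n IH]; simpl; [lra|].
    pose proof (pow_le (Cmod q) n (Cmod_ge_0 q)); lra. }
  assert (0 <= Cmod a * Cmod q ^ n)%R.
  { apply Rmult_le_pos; [apply Cmod_ge_0|apply pow_le, Cmod_ge_0]. }
  pose proof (Cmod_ge_0 (1 - a * q ^ n)).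
  nra. }
assert (HL := clim_Cmod _ _ (qpoch_lim a q Hq)).
rewrite E, Cmod_0 in HL.
assert (Hle : Rbar_le (/ 2)%R 0).
{ apply (is_lim_seq_le (fun _ => / 2)%R (fun n => Cmod (qpoch_fin a q n)));
    [|apply is_lim_seq_const|exact HL].
  intros n; specialize (H n); lra. }
simpl in Hle; lra.
Qed.

(** Peeling off N nonzero factors with [qpoch_shift] replaces a by a q^N, which is small enough for
    [qpoch_neq_0_small]. *)
Lemma qpoch_neq_0 (a q : C) :
  (Cmod q < 1)%R -> (Cmod a < 1)%R -> qpoch a q <> 0.
Proof.
intros Hq Ha.
assert (HN : exists N, (Cmod (a * q ^ N) <= (1 - Cmod q) / 2)%R).
{ assert (HL : is_lim_seq (fun n => Cmod q ^ n)%R 0).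
  { apply is_lim_seq_geom; rewrite Rabs_pos_eq; [exact Hq|apply Cmod_ge_0]. }
  apply is_lim_seq_spec in HL.
  assert (He : (0 < (1 - Cmod q) / 2)%R) by lra.
  destruct (HL (mkposreal _ He)) as [N HN]; exists N.
  specialize (HN N (le_n N)); simpl in HN; rewrite Rminus_0_r in HN.
  rewrite Cmod_mult, Cmod_pow.
  pose proof (pow_le (Cmod q) N (Cmod_ge_0 q)).
  rewrite Rabs_pos_eq in HN by assumption.
  pose proof (Cmod_ge_0 a); nra. }
destruct HN as [N HN]; revert a Ha HN; induction N as [|N IH]; intros a Ha HN.
- apply qpoch_neq_0_small; [exact Hq|].
  now replace (a * q ^ 0) with a in HN by ring.
- rewrite qpoch_shift by exact Hq.
  apply Cmult_neq_0; [now apply one_minus_neq_0|].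
  apply IH.
  + pose proof (Cmod_mul_pow_lt a q 1 Hq Ha) as H.
    now rewrite Cpow_1_r in H.
  + now replace (a * q * q ^ N) with (a * q ^ S N) by (rewrite Cpow_S; ring).
Qed.

(** * The Jacobi triple product *)

Lemma Copp_neq_0 (z : C) : z <> 0 -> - z <> 0.
Proof.
intros Hz E; apply Hz; replace z with (- - z) by ring; rewrite E; ring.
Qed.

Lemma Cinv_neq_0 (z : C) : z <> 0 -> / z <> 0.
Proof.
intros Hz E; apply C1_nz.
rewrite <- (Cinv_r z Hz), E; ring.
Qed.

(** * Integer powers and the terms of a theta series *)

Definition zpow (z : C) (n : Z) : C :=
  match n with
  | Z0 => 1
  | Zpos k => z ^ Pos.to_nat k
  | Zneg k => / z ^ Pos.to_nat k
  end.

Lemma zpow_of_nat (z : C) (n : nat) : zpow z (Z.of_nat n) = z ^ n.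
Proof.
destruct n as [|n]; [reflexivity|].
simpl Z.of_nat; unfold zpow; now rewrite SuccNat2Pos.id_succ.
Qed.

Lemma zpow_opp_of_nat (z : C) (n : nat) : zpow z (- Z.of_nat n) = / z ^ n.
Proof.
destruct n as [|n].
- simpl; field.
- simpl Z.of_nat; unfold zpow, Z.opp; now rewrite SuccNat2Pos.id_succ.
Qed.

Lemma zpow_neq_0 (z : C) (n : Z) : z <> 0 -> zpow z n <> 0.
Proof.
intros Hz; destruct n; simpl.
- apply C1_nz.
- now apply Cpow_nz.
- now apply Cinv_neq_0, Cpow_nz.
Qed.

Lemma zpow_succ (z : C) (n : Z) : z <> 0 -> zpow z (n + 1) = z * zpow z n.
Proof.
intros Hz; destruct (Z_lt_le_dec n 0) as [Hn|Hn].
- replace n with (- Z.of_nat (S (Z.to_nat (- n - 1))))%Z at 2 by lia.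
  replace (n + 1)%Z with (- Z.of_nat (Z.to_nat (- n - 1)))%Z by lia.
  rewrite !zpow_opp_of_nat, Cpow_S; field.
  split; [now apply Cpow_nz|exact Hz].
- replace n with (Z.of_nat (Z.to_nat n)) by lia.
  replace (Z.of_nat (Z.to_nat n) + 1)%Z
    with (Z.of_nat (S (Z.to_nat n))) by lia.
  now rewrite !zpow_of_nat, Cpow_S.
Qed.

Lemma zpow_add (z : C) (m n : Z) :
  z <> 0 -> zpow z (m + n) = zpow z m * zpow z n.
Proof.
intros Hz; induction n as [|n IH|n IH] using Z.peano_ind.
- rewrite Z.add_0_r; simpl; ring.
- replace (m + Z.succ n)%Z with (m + n + 1)%Z by lia.
  unfold Z.succ; rewrite !zpow_succ, IH by assumption; ring.
- assert (H1 := zpow_succ z (m + Z.pred n) Hz).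
  assert (H2 := zpow_succ z (Z.pred n) Hz).
  replace (m + Z.pred n + 1)%Z with (m + n)%Z in H1 by lia.
  replace (Z.pred n + 1)%Z with n in H2 by lia.
  rewrite H1, H2 in IH.
  replace (zpow z (m + Z.pred n)) with (/ z * (z * zpow z (m + Z.pred n)))
    by (field; exact Hz).
  rewrite IH; field; exact Hz.
Qed.

Lemma zpow_mul (a b : C) (n : Z) :
  a <> 0 -> b <> 0 -> zpow (a * b) n = zpow a n * zpow b n.
Proof.
intros Ha Hb; destruct n; simpl; [ring|apply Cpow_mult_l|].
rewrite Cpow_mult_l; field; split; now apply Cpow_nz.
Qed.

Lemma zpow_sqr (z : C) (n : Z) : z <> 0 -> zpow (z ^ 2) n = zpow z (2 * n).
Proof.
intros Hz.
replace (z ^ 2) with (z * z) by ring.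
rewrite zpow_mul by exact Hz.
now replace (2 * n)%Z with (n + n)%Z by lia; rewrite zpow_add.
Qed.

Lemma zpow_opp (z : C) (n : Z) : z <> 0 -> zpow z (- n) = / zpow z n.
Proof.
intros Hz; destruct n; simpl; [field|reflexivity|].
field; now apply Cpow_nz.
Qed.

Lemma zpow_inv (z : C) (n : Z) : z <> 0 -> zpow (/ z) n = / zpow z n.
Proof.
intros Hz; destruct n; simpl; [field|now apply Cpow_inv|].
now rewrite Cpow_inv.
Qed.

Definition tri (m : Z) : Z := (m * (m - 1) / 2)%Z.

(** Later identities between triangular numbers, also at negative arguments, are all deduced from
    this division-free form. *)
Lemma tri_double (m : Z) : (2 * tri m = m * (m - 1))%Z.
Proof.
unfold tri; symmetry; apply Z_div_exact_full_2; [lia|].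
destruct (Zeven_odd_dec m) as [H|H].
- destruct (Zeven_ex m H) as [k ->].
  replace (2 * k * (2 * k - 1))%Z with (k * (2 * k - 1) * 2)%Z by ring.
  apply Z_mod_mult.
- destruct (Zodd_ex m H) as [k ->].
  replace ((2 * k + 1) * (2 * k + 1 - 1))%Z with ((2 * k + 1) * k * 2)%Z
    by ring.
  apply Z_mod_mult.
Qed.

Definition theta_term (p a : C) (m : Z) : C := zpow p (tri m) * zpow a m.

Lemma theta_term_succ (p a : C) (m : Z) :
  p <> 0 -> a <> 0 ->
  theta_term p a (m + 1) = a * zpow p m * theta_term p a m.
Proof.
intros Hp Ha; unfold theta_term.
replace (tri (m + 1)) with (tri m + m)%Z
  by (pose proof (tri_double m); pose proof (tri_double (m + 1)); lia).
rewrite zpow_add, zpow_succ by assumption; ring.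
Qed.

Lemma theta_term_neq_0 (p a : C) (m : Z) :
  p <> 0 -> a <> 0 -> theta_term p a m <> 0.
Proof. intros Hp Ha; apply Cmult_neq_0; now apply zpow_neq_0. Qed.

(** Reflection exchanges a and p / a, so one ratio test covers both halves of the series. *)
Lemma theta_term_opp (p a : C) (m : Z) :
  p <> 0 -> a <> 0 -> theta_term p a (- m) = theta_term p (p / a) m.
Proof.
intros Hp Ha; unfold theta_term, Cdiv.
replace (tri (- m)) with (tri m + m)%Z
  by (pose proof (tri_double m); pose proof (tri_double (- m)); lia).
rewrite zpow_mul, zpow_add, zpow_opp, zpow_inv;
  auto using Cinv_neq_0; ring.
Qed.

Lemma ex_series_theta_term (p a : C) :
  p <> 0 -> a <> 0 -> (Cmod p < 1)%R ->
  ex_series (fun n => Cmod (theta_term p a (Z.of_nat n))).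
Proof.
intros Hp Ha Hp1.
apply ex_series_ext with
  (fun n => Rabs (Cmod (theta_term p a (Z.of_nat n)))).
{ intros n; apply Rabs_pos_eq, Cmod_ge_0. }
apply ex_series_DAlembert with 0%R.
- lra.
- intros n; apply Rgt_not_eq, Cmod_gt_0; now apply theta_term_neq_0.
- apply is_lim_seq_ext with (fun n => Cmod a * Cmod p ^ n)%R.
  + intros n.
    replace (Z.of_nat (S n)) with (Z.of_nat n + 1)%Z by lia.
    rewrite theta_term_succ, zpow_of_nat, !Cmod_mult, Cmod_pow by assumption.
    rewrite Rabs_pos_eq.
    * field; apply Rgt_not_eq, Cmod_gt_0; now apply theta_term_neq_0.
    * apply Rdiv_le_0_compat; [|apply Cmod_gt_0; now apply theta_term_neq_0].
      repeat apply Rmult_le_pos; try apply pow_le; apply Cmod_ge_0.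
  + replace (Finite 0) with (Finite (Cmod a * 0)) by (f_equal; ring).
    apply is_lim_seq_mult'; [apply is_lim_seq_const|].
    apply is_lim_seq_geom; rewrite Rabs_pos_eq; [exact Hp1|apply Cmod_ge_0].
Qed.

(* The terms of a sum over [Z] with index of absolute value [k], so that
   [csum (zfold f) n] sums [f] over [|m| < n]. *)
Definition zfold (f : Z -> C) (k : nat) : C :=
  match k with
  | O => f 0%Z
  | S _ => f (Z.of_nat k) + f (- Z.of_nat k)%Z
  end.

Definition zsum (f : Z -> C) : C :=
  iota (T := C_CompleteNormedModule)
    (fun l : C => filterlim (csum (zfold f)) eventually (locally l)).

Definition zabs (f : Z -> C) : Prop :=
  ex_series (fun n => Cmod (f (Z.of_nat n))) /\
  ex_series (fun n => Cmod (f (- Z.of_nat n)%Z)).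

Lemma zfold_ext (f g : Z -> C) (k : nat) :
  (forall m, f m = g m) -> zfold f k = zfold g k.
Proof. intros H; destruct k; simpl; now rewrite !H. Qed.

Lemma zfold_scal (c : C) (f : Z -> C) (k : nat) :
  zfold (fun m => c * f m) k = c * zfold f k.
Proof. destruct k; simpl; ring. Qed.

Lemma zfold_plus (f g : Z -> C) (k : nat) :
  zfold (fun m => f m + g m) k = zfold f k + zfold g k.
Proof. destruct k; simpl; ring. Qed.

Lemma zfold_le (f : Z -> C) (k : nat) :
  (Cmod (zfold f k)
   <= Cmod (f (Z.of_nat k)) + Cmod (f (- Z.of_nat k)%Z))%R.
Proof.
destruct k as [|k].
- simpl; pose proof (Cmod_ge_0 (f 0%Z)); lra.
- apply Cmod_triangle.
Qed.

Lemma zabs_plus (f : Z -> C) :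
  zabs f -> ex_series (fun k =>
    Cmod (f (Z.of_nat k)) + Cmod (f (- Z.of_nat k)%Z))%R.
Proof. intros [H1 H2]; exact (ex_series_plus _ _ H1 H2). Qed.

Lemma zabs_zfold (f : Z -> C) :
  zabs f -> ex_series (fun k => Cmod (zfold f k)).
Proof.
intros H; apply (ex_series_le (V := R_CompleteNormedModule))
  with (2 := zabs_plus f H).
intros k; change norm with Rabs; cbn beta.
rewrite Rabs_pos_eq by apply Cmod_ge_0; apply zfold_le.
Qed.

Lemma zsum_lim (f : Z -> C) : zabs f -> clim (csum (zfold f)) (zsum f).
Proof.
intros H; destruct (csum_abs_cv _ (zabs_zfold f H)) as [l Hl].
replace (zsum f) with l; [exact Hl|].
symmetry; apply (iota_filterlim_locally (V := C_CompleteNormedModule)).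
now apply clim_filterlim.
Qed.

Lemma zabs_theta_term (p a : C) :
  p <> 0 -> a <> 0 -> (Cmod p < 1)%R -> zabs (theta_term p a).
Proof.
intros Hp Ha Hp1; split; [now apply ex_series_theta_term|].
apply ex_series_ext with
  (fun n => Cmod (theta_term p (p / a) (Z.of_nat n))).
- intros n; now rewrite theta_term_opp.
- apply ex_series_theta_term; auto.
  apply Cmult_neq_0; [exact Hp|now apply Cinv_neq_0].
Qed.

(** Shifting the window |m| <= n gains one boundary term and loses another. In
    [finite_jacobi_triple] both lie outside the support. *)
Lemma csum_zfold_succ (f : Z -> C) (n : nat) :
  csum (zfold (fun m => f (m + 1)%Z)) (S n)
  = csum (zfold f) (S n) + f (Z.of_nat n + 1)%Z - f (- Z.of_nat n)%Z.
Proof.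
induction n as [|n IH]; [simpl; ring|].
change (csum (zfold (fun m => f (m + 1)%Z)) (S (S n)))
  with (csum (zfold (fun m => f (m + 1)%Z)) (S n)
        + (f (Z.of_nat (S n) + 1)%Z + f (- Z.of_nat (S n) + 1)%Z)).
change (csum (zfold f) (S (S n)))
  with (csum (zfold f) (S n)
        + (f (Z.of_nat (S n)) + f (- Z.of_nat (S n))%Z)).
rewrite IH.
replace (- Z.of_nat (S n) + 1)%Z with (- Z.of_nat n)%Z by lia.
replace (Z.of_nat n + 1)%Z with (Z.of_nat (S n)) by lia.
ring.
Qed.

Lemma csum_zfold_pred (f : Z -> C) (n : nat) :
  csum (zfold (fun m => f (m - 1)%Z)) (S n)
  = csum (zfold f) (S n) - f (Z.of_nat n) + f (- Z.of_nat n - 1)%Z.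
Proof.
assert (H := csum_zfold_succ (fun i => f (i - 1)%Z) n); cbn beta in H.
rewrite (csum_ext _ (zfold f)) in H.
- rewrite H; replace (Z.of_nat n + 1 - 1)%Z with (Z.of_nat n) by lia; ring.
- intros k _; apply zfold_ext; intros m; f_equal; lia.
Qed.

(* [1 / (p;p)_k], extended by [0] to negative [k] so that
   [inv_poch_pred] holds for every integer. *)
Definition inv_poch (p : C) (k : Z) : C :=
  if Z_lt_dec k 0 then 0 else / qpoch_fin p p (Z.to_nat k).

Lemma inv_poch_neg (p : C) (k : Z) : (k < 0)%Z -> inv_poch p k = 0.
Proof. intros H; unfold inv_poch; destruct (Z_lt_dec k 0); [easy|lia]. Qed.

Lemma inv_poch_of_nat (p : C) (n : nat) :
  inv_poch p (Z.of_nat n) = / qpoch_fin p p n.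
Proof.
unfold inv_poch; destruct (Z_lt_dec _ 0); [lia|]; now rewrite Nat2Z.id.
Qed.

Lemma inv_poch_pred (p : C) (k : Z) :
  (Cmod p < 1)%R -> inv_poch p (k - 1) = (1 - zpow p k) * inv_poch p k.
Proof.
intros Hp; destruct (Z_lt_le_dec k 0) as [Hk|Hk].
- rewrite !inv_poch_neg by lia; ring.
- replace k with (Z.of_nat (Z.to_nat k)) by lia.
  destruct (Z.to_nat k) as [|n].
  + rewrite inv_poch_neg by lia; simpl; ring.
  + replace (Z.of_nat (S n) - 1)%Z with (Z.of_nat n) by lia.
    rewrite !inv_poch_of_nat, zpow_of_nat; cbn [qpoch_fin].
    rewrite <- Cpow_S; field; split.
    * rewrite Cpow_S; now apply one_minus_neq_0, Cmod_mul_pow_lt.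
    * now apply qpoch_fin_neq_0.
Qed.

Lemma inv_poch_bound (p : C) :
  (Cmod p < 1)%R -> exists B, forall k, (Cmod (inv_poch p k) <= B)%R.
Proof.
intros Hp.
destruct (filterlim_bounded (V := C_CompleteNormedModule)
            (fun n => / qpoch_fin p p n)) as [B HB].
- exists (/ qpoch p p); apply clim_filterlim, clim_inv.
  + now apply qpoch_neq_0.
  + intros n; now apply qpoch_fin_neq_0.
  + now apply qpoch_lim.
- exists B; intros k.
  destruct (Z_lt_le_dec k 0) as [Hk|Hk].
  + rewrite inv_poch_neg, Cmod_0 by exact Hk.
    eapply Rle_trans; [apply Cmod_ge_0|apply (HB O)].
  + replace k with (Z.of_nat (Z.to_nat k)) by lia.
    rewrite inv_poch_of_nat; apply HB.
Qed.

Lemma inv_poch_lim (p : C) (m : Z) :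
  (Cmod p < 1)%R ->
  clim (fun n => inv_poch p (Z.of_nat n + m)) (/ qpoch p p).
Proof.
(* From index |m| on, the argument n + m is nonnegative and [inv_poch] is a genuine reciprocal. *)
intros Hp; apply clim_unsubseq with (Z.abs_nat m).
apply clim_ext with
  (fun n => / qpoch_fin p p (n + Z.to_nat (m + Z.abs m))).
- intros n; rewrite <- inv_poch_of_nat; f_equal; lia.
- apply (clim_subseq (fun n => / qpoch_fin p p n) _
           (fun n => (n + Z.to_nat (m + Z.abs m))%nat)); [lia|].
  apply clim_inv.
  + now apply qpoch_neq_0.
  + intros n; now apply qpoch_fin_neq_0.
  + now apply qpoch_lim.
Qed.

(** Multiplied by (p;p)_{2N}, the two reciprocals form the Gaussian binomial coefficient of 2N over
    N + m. *)
Definition jacobi_term (p a : C) (N m : Z) : C :=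
  theta_term p (- a) m * (inv_poch p (N - m) * inv_poch p (N + m)).

Lemma jacobi_term_out (p a : C) (N m : Z) :
  (N < Z.abs m)%Z -> jacobi_term p a N m = 0.
Proof.
intros H; unfold jacobi_term; destruct (Z_lt_le_dec m 0).
- rewrite (inv_poch_neg p (N + m)) by lia; ring.
- rewrite (inv_poch_neg p (N - m)) by lia; ring.
Qed.

(** This is the q-Pascal rule applied twice. The right side collects the terms of (1 - a p^N)(1 -
    p^(N+1)/a), the factors by which the finite product grows; the prefactor on the left is
    (p;p)_{2N+2} / (p;p)_{2N}. *)
Lemma jacobi_term_rec (p a : C) (N m : Z) :
  p <> 0 -> a <> 0 -> (Cmod p < 1)%R ->
  (1 - zpow p (2 * N + 1)) * (1 - zpow p (2 * N + 2))
    * jacobi_term p a (N + 1) m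
  = (1 + zpow p (2 * N + 1)) * jacobi_term p a N m
    + (- a * zpow p N) * jacobi_term p a N (m - 1)
    + (- zpow p (N + 1) / a) * jacobi_term p a N (m + 1).
Proof.
intros Hp Ha Hp1; unfold jacobi_term.
assert (Ha' : - a <> 0) by now apply Copp_neq_0.
assert (E := theta_term_succ p (- a) (m - 1) Hp Ha').
replace (m - 1 + 1)%Z with m in E by lia.
rewrite theta_term_succ by assumption.
(* Every argument of [inv_poch] is written as N + 1 - m or N + 1 + m lowered by 0, 1 or 2. Then
   [inv_poch_pred], valid at all integers, leaves a rational identity in p^N and p^m with no
   boundary cases. *)
replace (N - (m + 1))%Z with (N + 1 - m - 1 - 1)%Z by lia.
replace (N - (m - 1))%Z with (N + 1 - m)%Z by lia.
replace (N + (m + 1))%Z with (N + 1 + m)%Z by lia.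
replace (N + (m - 1))%Z with (N + 1 + m - 1 - 1)%Z by lia.
replace (N - m)%Z with (N + 1 - m - 1)%Z by lia.
replace (N + m)%Z with (N + 1 + m - 1)%Z by lia.
rewrite !inv_poch_pred by assumption.
rewrite E; clear E.
assert (Hm := zpow_neq_0 p m Hp).
replace (2 * N + 1)%Z with (N + N + 1)%Z by lia.
replace (2 * N + 2)%Z with (N + N + 1 + 1)%Z by lia.
replace (N + 1 - m - 1)%Z with (N + - m)%Z by lia.
replace (N + 1 + m - 1)%Z with (N + m)%Z by lia.
replace (zpow p (N + 1 - m)) with (p * zpow p N / zpow p m).
2: { unfold Z.sub; rewrite zpow_add, zpow_succ, zpow_opp by assumption.
     reflexivity. }
replace (zpow p (m - 1)) with (zpow p m / p).
2: { replace (zpow p m) with (zpow p (m - 1 + 1)) by (f_equal; lia).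
     rewrite zpow_succ by assumption; field; assumption. }
rewrite !(zpow_add p _ m), !zpow_succ, !zpow_add, !zpow_opp by assumption.
rewrite ?zpow_succ by assumption.
field; auto.
Qed.

(** The window n is kept apart from N so that the induction hypothesis for N can be used on the same
    window n > N, where shifting m costs nothing. *)
Lemma finite_jacobi_triple (p a : C) (N n : nat) :
  p <> 0 -> a <> 0 -> (Cmod p < 1)%R -> (N <= n)%nat ->
  qpoch_fin p p (2 * N) * csum (zfold (jacobi_term p a (Z.of_nat N))) (S n)
  = qpoch_fin a p N * qpoch_fin (p / a) p N.
Proof.
intros Hp Ha Hp1; revert n; induction N as [|N IH]; intros n Hn.
- induction n as [|n IHn].
  + simpl; unfold jacobi_term, theta_term, inv_poch; simpl; field.
  + specialize (IHn ltac:(lia)).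
    change (csum (zfold (jacobi_term p a (Z.of_nat 0))) (S (S n)))
      with (csum (zfold (jacobi_term p a (Z.of_nat 0))) (S n)
            + zfold (jacobi_term p a (Z.of_nat 0)) (S n)).
    replace (zfold (jacobi_term p a (Z.of_nat 0)) (S n)) with (RtoC 0).
    * rewrite <- IHn; ring.
    * unfold zfold; rewrite !jacobi_term_out by lia; ring.
- set (j := jacobi_term p a (Z.of_nat N)) in *.
  replace (2 * S N)%nat with (S (S (2 * N))) by lia.
  cbn [qpoch_fin]; rewrite <- !Cpow_S.
  transitivity (qpoch_fin p p (2 * N) * csum (zfold (fun m =>
    (1 + zpow p (2 * Z.of_nat N + 1)) * j m
    + (- a * zpow p (Z.of_nat N)) * j (m - 1)%Z
    + (- zpow p (Z.of_nat N + 1) / a) * j (m + 1)%Z)) (S n)).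
  + rewrite <- !Cmult_assoc; f_equal; rewrite Cmult_assoc, <- csum_scal.
    apply csum_ext; intros k _; rewrite <- zfold_scal; apply zfold_ext.
    intros m; unfold j.
    rewrite <- (jacobi_term_rec p a (Z.of_nat N) m Hp Ha Hp1).
    rewrite <- !zpow_of_nat.
    replace (Z.of_nat (S (2 * N))) with (2 * Z.of_nat N + 1)%Z by lia.
    replace (Z.of_nat (S (S (2 * N)))) with (2 * Z.of_nat N + 2)%Z by lia.
    replace (Z.of_nat (S N)) with (Z.of_nat N + 1)%Z by lia.
    reflexivity.
  + rewrite (csum_ext _ (fun k =>
      (1 + zpow p (2 * Z.of_nat N + 1)) * zfold j k
      + (- a * zpow p (Z.of_nat N)) * zfold (fun m => j (m - 1)%Z) k
      + (- zpow p (Z.of_nat N + 1) / a) * zfold (fun m => j (m + 1)%Z) k)).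
    2: { intros k _; now rewrite !zfold_plus, !zfold_scal. }
    rewrite !csum_plus, !csum_scal, csum_zfold_succ, csum_zfold_pred.
    (* These are the four boundary terms of the two shifts, at n, -n-1, n+1 and -n, all beyond N in
       absolute value. *)
    unfold j at 3 4 6 7; rewrite !jacobi_term_out by lia; fold j.
    specialize (IH n ltac:(lia)).
    transitivity (qpoch_fin p p (2 * N) * csum (zfold j) (S n)
      * ((1 - a * p ^ N) * (1 - p / a * p ^ N))).
    * replace (2 * Z.of_nat N + 1)%Z with (Z.of_nat N + Z.of_nat N + 1)%Z
        by lia.
      rewrite !zpow_succ, !zpow_add, zpow_of_nat by assumption.
      field; assumption.
    * rewrite IH; ring.
Qed.

Definition qtheta (a p : C) : C := qpoch a p * qpoch (p / a) p.

(** As N grows, the prefactor tends to (p;p) and each pair of reciprocals to 1/(p;p)^2; boundedness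
    of [inv_poch] makes the theta terms themselves a majorant. *)
Theorem jacobi_triple_product (p a : C) :
  p <> 0 -> a <> 0 -> (Cmod p < 1)%R ->
  qpoch p p * qtheta a p = zsum (theta_term p (- a)).
Proof.
intros Hp Ha Hp1.
assert (HP : qpoch p p <> 0) by now apply qpoch_neq_0.
assert (Habs : zabs (theta_term p (- a)))
  by (apply zabs_theta_term; auto using Copp_neq_0).
assert (H : qtheta a p = qpoch p p *
  (/ qpoch p p * / qpoch p p * zsum (theta_term p (- a)))).
2: { rewrite H; field; exact HP. }
apply clim_unique with (fun N => qpoch_fin a p N * qpoch_fin (p / a) p N).
{ apply clim_mult; now apply qpoch_lim. }
apply clim_ext with (fun N => qpoch_fin p p (2 * N)
  * csum (zfold (jacobi_term p a (Z.of_nat N))) (S N)).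
{ intros N; now apply finite_jacobi_triple. }
apply clim_mult.
{ apply (clim_subseq (qpoch_fin p p) _ (fun n => (2 * n)%nat)); [lia|].
  now apply qpoch_lim. }
destruct (inv_poch_bound p Hp1) as [B HB].
assert (Hterm : forall N m,
  (Cmod (jacobi_term p a N m) <= B * B * Cmod (theta_term p (- a) m))%R).
{ intros N m; unfold jacobi_term; rewrite !Cmod_mult, Rmult_comm.
  apply Rmult_le_compat_r; [apply Cmod_ge_0|].
  apply Rmult_le_compat; auto; apply Cmod_ge_0. }
(* The row for N has N + 1 terms while [tannery] sums row n over n terms, hence the reindexing by
   [pred]. *)
apply (clim_subseq
  (fun n => csum (zfold (jacobi_term p a (Z.of_nat (pred n)))) n) _ S);
  [lia|].
apply tannery with
  (s := zfold (fun m => / qpoch p p * / qpoch p p * theta_term p (- a) m))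
  (M := fun k => (B * B * (Cmod (theta_term p (- a) (Z.of_nat k))
                  + Cmod (theta_term p (- a) (- Z.of_nat k))))%R).
- intros n k _; eapply Rle_trans; [apply zfold_le|].
  rewrite Rmult_plus_distr_l; now apply Rplus_le_compat.
- exact (ex_series_scal_l (B * B)%R _ (zabs_plus _ Habs)).
- assert (Hlim : forall m, clim
    (fun n => jacobi_term p a (Z.of_nat (pred n)) m)
    (/ qpoch p p * / qpoch p p * theta_term p (- a) m)).
  { intros m; apply clim_unsubseq with 1%nat.
    apply clim_ext with (fun n => inv_poch p (Z.of_nat n + - m)
      * inv_poch p (Z.of_nat n + m) * theta_term p (- a) m).
    - intros n; unfold jacobi_term.
      replace (pred (n + 1)) with n by lia; unfold Z.sub; ring.
    - apply clim_mult; [|apply clim_const].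
      apply clim_mult; now apply inv_poch_lim. }
  intros [|k]; [apply Hlim|now apply clim_plus].
- apply clim_ext with (fun n => / qpoch p p * / qpoch p p
    * csum (zfold (theta_term p (- a))) n).
  + intros n; rewrite <- csum_scal; apply csum_ext.
    intros k _; now rewrite zfold_scal.
  + now apply clim_scal, zsum_lim.
Qed.

(** * Products of two theta series *)

(** Summing over lists lets a finite double sum be rearranged through [Permutation], in
    [lsum_perm]. *)
Definition lsum {A : Type} (f : A -> C) (l : list A) : C :=
  fold_right (fun x s => f x + s) 0 l.

Lemma lsum_app {A : Type} (f : A -> C) (l l' : list A) :
  lsum f (l ++ l') = lsum f l + lsum f l'.
Proof. induction l as [|x l IH]; simpl; [|rewrite IH]; ring. Qed.

Lemma lsum_ext {A : Type} (f g : A -> C) (l : list A) :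
  (forall x, f x = g x) -> lsum f l = lsum g l.
Proof. intros H; induction l as [|x l IH]; simpl; congruence. Qed.

Lemma lsum_scal {A : Type} (c : C) (f : A -> C) (l : list A) :
  lsum (fun x => c * f x) l = c * lsum f l.
Proof. induction l as [|x l IH]; simpl; [|rewrite IH]; ring. Qed.

Lemma lsum_map {A B : Type} (f : B -> C) (g : A -> B) (l : list A) :
  lsum f (map g l) = lsum (fun x => f (g x)) l.
Proof. induction l as [|x l IH]; simpl; congruence. Qed.

Lemma lsum_flat_map {A B : Type} (f : B -> C) (g : A -> list B) (l : list A) :
  lsum f (flat_map g l) = lsum (fun x => lsum f (g x)) l.
Proof.
induction l as [|x l IH]; simpl; [easy|]; now rewrite lsum_app, IH.
Qed.

Lemma lsum_perm {A : Type} (f : A -> C) (l l' : list A) :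
  Permutation l l' -> lsum f l = lsum f l'.
Proof. induction 1; simpl; try congruence; ring. Qed.

Lemma lsum_seq (u : nat -> C) (n : nat) : lsum u (seq 0 n) = csum u n.
Proof.
induction n as [|n IH]; [easy|].
rewrite seq_S, lsum_app, IH; simpl; ring.
Qed.

Lemma NoDup_flat_map {A B : Type} (g : A -> list B) (l : list A) :
  NoDup l -> (forall x, NoDup (g x)) ->
  (forall x y z, In z (g x) -> In z (g y) -> x = y) ->
  NoDup (flat_map g l).
Proof.
intros Hl Hg Hd; induction Hl as [|x l Hx Hl IH]; simpl; [constructor|].
apply NoDup_app; auto.
intros z Hz Hz'; apply in_flat_map in Hz'; destruct Hz' as (y & Hy & Hzy).
now rewrite (Hd x y z) in Hx.
Qed.

Lemma NoDup_list_prod {A B : Type} (l : list A) (l' : list B) :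
  NoDup l -> NoDup l' -> NoDup (list_prod l l').
Proof.
intros Hl Hl'; rewrite list_prod_as_flat_map; apply NoDup_flat_map; auto.
- intros x; apply FinFun.Injective_map_NoDup; [|exact Hl'].
  intros y y' E; now injection E.
- intros x y z Hx Hy; apply in_map_iff in Hx; apply in_map_iff in Hy.
  destruct Hx as (u & <- & _), Hy as (v & E & _); now injection E.
Qed.

(** * Rearranging a square of index pairs into two diamonds *)

Definition shells (sh : nat -> list Z) (level : Z -> nat) : Prop :=
  (forall k, NoDup (sh k)) /\ (forall k z, In z (sh k) <-> level z = k).

Definition shell_ball (sh : nat -> list Z) (n : nat) : list Z :=
  flat_map sh (seq 0 n).

Lemma In_shell_ball sh level n z :
  shells sh level -> In z (shell_ball sh n) <-> (level z < n)%nat.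
Proof.
intros [_ H]; unfold shell_ball; rewrite in_flat_map; split.
- intros (k & Hk & Hz); apply in_seq in Hk; apply H in Hz; lia.
- intros Hz; exists (level z); split; [apply in_seq; lia|now apply H].
Qed.

Lemma NoDup_shell_ball sh level n :
  shells sh level -> NoDup (shell_ball sh n).
Proof.
intros [Hn H]; apply NoDup_flat_map; [apply seq_NoDup|exact Hn|].
intros k j z Hk Hj; apply H in Hk; apply H in Hj; congruence.
Qed.

(** The images under h of the pairs whose levels add up to less than n, listed so that the sum over
    them is literally a truncated Cauchy product. *)
Definition diamond (shx shy : nat -> list Z) (h : Z -> Z -> Z * Z) (n : nat) :
  list (Z * Z) :=
  flat_map (fun k => flat_map (fun r => map (h r) (shell_ball shy (n - k)))
                       (shx k)) (seq 0 n).

Lemma lsum_diamond shx shy h n (F : Z * Z -> C) (x y : Z -> C) :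
  (forall r s, F (h r s) = x r * y s) ->
  lsum F (diamond shx shy h n)
  = csum (fun k => lsum x (shx k)
                   * csum (fun j => lsum y (shy j)) (n - k)) n.
Proof.
intros H; unfold diamond; rewrite lsum_flat_map, lsum_seq.
apply csum_ext; intros k _; rewrite lsum_flat_map.
rewrite Cmult_comm, <- lsum_scal; apply lsum_ext; intros r.
rewrite lsum_map, (lsum_ext _ (fun s => x r * y s)) by (intros; apply H).
rewrite lsum_scal; unfold shell_ball; rewrite lsum_flat_map, lsum_seq; ring.
Qed.

Lemma In_diamond shx shy lx ly h n z :
  shells shx lx -> shells shy ly ->
  In z (diamond shx shy h n) <->
  exists r s, h r s = z /\ (lx r + ly s < n)%nat.
Proof.
intros Hx Hy; unfold diamond; rewrite in_flat_map; split.
- intros (k & Hk & Hz); apply in_flat_map in Hz.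
  destruct Hz as (r & Hr & Hz); apply in_map_iff in Hz.
  destruct Hz as (s & Hs & Hin); apply (In_shell_ball _ ly) in Hin; auto.
  apply Hx in Hr; exists r, s; split; [exact Hs|lia].
- intros (r & s & Hs & Hlt); exists (lx r); split; [apply in_seq; lia|].
  apply in_flat_map; exists r; split; [now apply Hx|].
  apply in_map_iff; exists s; split; [exact Hs|].
  apply (In_shell_ball _ ly); [exact Hy|lia].
Qed.

Lemma NoDup_diamond shx shy lx ly h n :
  shells shx lx -> shells shy ly ->
  (forall r s r' s', h r s = h r' s' -> r = r' /\ s = s') ->
  NoDup (diamond shx shy h n).
Proof.
intros Hx Hy Hh; apply NoDup_flat_map; [apply seq_NoDup| |].
- intros k; apply NoDup_flat_map; [apply Hx| |].
  + intros r; apply FinFun.Injective_map_NoDup.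
    * intros s s' E; now apply Hh in E.
    * now apply (NoDup_shell_ball _ ly).
  + intros r r' z Hz Hz'; apply in_map_iff in Hz; apply in_map_iff in Hz'.
    destruct Hz as (s & <- & _), Hz' as (s' & E & _); symmetry.
    now apply Hh in E.
- intros k k' z Hz Hz'; apply in_flat_map in Hz; apply in_flat_map in Hz'.
  destruct Hz as (r & Hr & Hz), Hz' as (r' & Hr' & Hz').
  apply in_map_iff in Hz; apply in_map_iff in Hz'.
  destruct Hz as (s & <- & _), Hz' as (s' & E & _).
  apply Hh in E; destruct E as [-> _].
  apply Hx in Hr; apply Hx in Hr'; congruence.
Qed.

Definition sym_shell (k : nat) : list Z :=
  match k with
  | O => 0%Z :: nil
  | S _ => Z.of_nat k :: (- Z.of_nat k)%Z :: nil
  end.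

(* The integers at distance [k + 1/2] from [-1/2], resp. from [1/2]: the odd
   half of a square of pairs is a diamond with this centre. *)
Definition low_shell (k : nat) : list Z :=
  Z.of_nat k :: (- Z.of_nat k - 1)%Z :: nil.

Definition high_shell (k : nat) : list Z :=
  (Z.of_nat k + 1)%Z :: (- Z.of_nat k)%Z :: nil.

Definition low_level (z : Z) : nat :=
  if Z_lt_dec z 0 then Z.to_nat (- z - 1) else Z.to_nat z.

Definition high_level (z : Z) : nat :=
  if Z_lt_dec 0 z then Z.to_nat (z - 1) else Z.to_nat (- z).

Lemma NoDup_pair (x y : Z) : x <> y -> NoDup (x :: y :: nil).
Proof.
intros H; constructor; [simpl; intuition|].
constructor; [easy|constructor].
Qed.

Lemma sym_shells : shells sym_shell Z.abs_nat.
Proof.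
split; intros [|k].
- constructor; [easy|constructor].
- apply NoDup_pair; lia.
- intros z; simpl; lia.
- intros z; unfold sym_shell, In; lia.
Qed.

Lemma low_shells : shells low_shell low_level.
Proof.
split; intros k.
- apply NoDup_pair; lia.
- intros z; unfold low_shell, low_level, In.
  destruct (Z_lt_dec z 0); lia.
Qed.

Lemma high_shells : shells high_shell high_level.
Proof.
split; intros k.
- apply NoDup_pair; lia.
- intros z; unfold high_shell, high_level, In.
  destruct (Z_lt_dec 0 z); lia.
Qed.

Lemma lsum_sym_shell (f : Z -> C) (k : nat) :
  lsum f (sym_shell k) = zfold f k.
Proof. destruct k; simpl; ring. Qed.

Definition even_pair (r s : Z) : Z * Z := (r + s, r - s)%Z.

(** With r' = r + 1/2 and s' = s - 1/2 this is again the pair (r' + s', r' - s'), so the larger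
    absolute value of its entries is |r'| + |s'| = [low_level r + high_level s + 1]. For [even_pair]
    it is |r| + |s|; the extra 1 is why the odd diamond has size N when the even one has size N +
    1. *)
Definition odd_pair (r s : Z) : Z * Z := (r + s, r - s + 1)%Z.

(* Splits [{(m, n) : |m|, |n| <= N}] by the parity of [m + n]. *)
Lemma square_diamonds (N : nat) :
  Permutation
    (list_prod (shell_ball sym_shell (S N)) (shell_ball sym_shell (S N)))
    (diamond sym_shell sym_shell even_pair (S N)
     ++ diamond low_shell high_shell odd_pair N).
Proof.
assert (HS := sym_shells).
assert (HL := low_shells); assert (HH := high_shells).
apply NoDup_Permutation.
- apply NoDup_list_prod; now apply (NoDup_shell_ball _ Z.abs_nat).
- apply NoDup_app.
  + apply (NoDup_diamond _ _ Z.abs_nat Z.abs_nat); auto.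
    unfold even_pair; intros r s r' s' E; injection E; lia.
  + apply (NoDup_diamond _ _ low_level high_level); auto.
    unfold odd_pair; intros r s r' s' E; injection E; lia.
  + intros [m n] H1 H2.
    apply (In_diamond _ _ Z.abs_nat Z.abs_nat) in H1; auto.
    apply (In_diamond _ _ low_level high_level) in H2; auto.
    destruct H1 as (r & s & E & _), H2 as (r' & s' & E' & _).
    unfold even_pair in E; unfold odd_pair in E'.
    injection E; injection E'; lia.
- intros [m n].
  rewrite in_prod_iff, !(In_shell_ball _ Z.abs_nat), in_app_iff by exact HS.
  rewrite (In_diamond _ _ Z.abs_nat Z.abs_nat) by exact HS.
  rewrite (In_diamond _ _ low_level high_level) by assumption.
  unfold even_pair, odd_pair, low_level, high_level; split.
  + intros [Hm Hn]; destruct (Zeven_odd_dec (m + n)) as [H|H].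
    * left; destruct (Zeven_ex _ H) as [r Hr]; exists r, (m - r)%Z.
      split; [f_equal; lia|lia].
    * right; destruct (Zodd_ex _ H) as [r Hr]; exists r, (m - r)%Z.
      split; [f_equal; lia|].
      destruct (Z_lt_dec r 0), (Z_lt_dec 0 (m - r)); lia.
  + intros [(r & s & E & H)|(r & s & E & H)]; injection E; intros <- <-.
    * lia.
    * destruct (Z_lt_dec r 0), (Z_lt_dec 0 s); lia.
Qed.

Lemma square_sum (f g : Z -> C) (n : nat) :
  lsum (fun z => f (fst z) * g (snd z))
    (list_prod (shell_ball sym_shell n) (shell_ball sym_shell n))
  = csum (zfold f) n * csum (zfold g) n.
Proof.
assert (Hball : forall h, lsum h (shell_ball sym_shell n) = csum (zfold h) n).
{ intros h; unfold shell_ball; rewrite lsum_flat_map, lsum_seq.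
  apply csum_ext; intros k _; apply lsum_sym_shell. }
(* Only the list that carries f is generalized; the one that carries g stays fixed in the
   induction. *)
rewrite <- !Hball; generalize (shell_ball sym_shell n) at 1 3.
intros l; induction l as [|x l IH]; simpl; [ring|].
rewrite lsum_app, IH, lsum_map; simpl.
rewrite lsum_scal; ring.
Qed.

Lemma clim_0_of_series (u : nat -> C) :
  ex_series (fun n => Cmod (u n)) -> clim u 0.
Proof.
intros H; apply ex_series_lim_0 in H.
apply is_lim_seq_ext with (2 := H).
intros n; f_equal; ring.
Qed.

(** The first n + 1 low shells cover -(n+1), ..., n: a symmetric window and one more term, which
    tends to 0. The high shells are the mirror image. *)
Lemma zsum_low_shell (f : Z -> C) :
  zabs f -> clim (csum (fun k => lsum f (low_shell k))) (zsum f).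
Proof.
intros H; apply clim_unsubseq with 1%nat.
apply clim_ext with
  (fun n => csum (zfold f) (n + 1) + f (- Z.of_nat (n + 1))%Z).
- intros n; rewrite Nat.add_1_r.
  induction n as [|n IH]; [simpl; ring|].
  change (csum (fun k => lsum f (low_shell k)) (S (S n)))
    with (csum (fun k => lsum f (low_shell k)) (S n)
          + (f (Z.of_nat (S n)) + (f (- Z.of_nat (S n) - 1)%Z + 0))).
  rewrite <- IH.
  change (csum (zfold f) (S (S n))) with (csum (zfold f) (S n)
    + (f (Z.of_nat (S n)) + f (- Z.of_nat (S n))%Z)).
  replace (- Z.of_nat (S n) - 1)%Z with (- Z.of_nat (S (S n)))%Z by lia.
  ring.
- replace (zsum f) with (zsum f + 0) by ring; apply clim_plus.
  + apply (clim_subseq (csum (zfold f)) _ (fun n => (n + 1)%nat)); [lia|].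
    now apply zsum_lim.
  + apply (clim_subseq (fun n => f (- Z.of_nat n)%Z) _
             (fun n => (n + 1)%nat)); [lia|].
    apply clim_0_of_series, H.
Qed.

Lemma zsum_high_shell (f : Z -> C) :
  zabs f -> clim (csum (fun k => lsum f (high_shell k))) (zsum f).
Proof.
intros H; apply clim_unsubseq with 1%nat.
apply clim_ext with
  (fun n => csum (zfold f) (n + 1) + f (Z.of_nat (n + 1))%Z).
- intros n; rewrite Nat.add_1_r.
  induction n as [|n IH]; [simpl; ring|].
  change (csum (fun k => lsum f (high_shell k)) (S (S n)))
    with (csum (fun k => lsum f (high_shell k)) (S n)
          + (f (Z.of_nat (S n) + 1)%Z + (f (- Z.of_nat (S n))%Z + 0))).
  rewrite <- IH.
  change (csum (zfold f) (S (S n))) with (csum (zfold f) (S n)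
    + (f (Z.of_nat (S n)) + f (- Z.of_nat (S n))%Z)).
  replace (Z.of_nat (S n) + 1)%Z with (Z.of_nat (S (S n))) by lia.
  ring.
- replace (zsum f) with (zsum f + 0) by ring; apply clim_plus.
  + apply (clim_subseq (csum (zfold f)) _ (fun n => (n + 1)%nat)); [lia|].
    now apply zsum_lim.
  + apply (clim_subseq (fun n => f (Z.of_nat n)) _
             (fun n => (n + 1)%nat)); [lia|].
    apply clim_0_of_series, H.
Qed.

Lemma ex_series_low_shell (f : Z -> C) :
  zabs f -> ex_series (fun k => Cmod (lsum f (low_shell k))).
Proof.
intros [H1 H2].
apply ex_series_incr_1 in H2.
apply (ex_series_le (V := R_CompleteNormedModule))
  with (2 := ex_series_plus _ _ H1 H2).
intros k; change norm with Rabs; cbn beta.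
rewrite Rabs_pos_eq by apply Cmod_ge_0.
replace (lsum f (low_shell k))
  with (f (Z.of_nat k) + f (- Z.of_nat (S k))%Z).
- apply Cmod_triangle.
- replace (- Z.of_nat (S k))%Z with (- Z.of_nat k - 1)%Z by lia.
  simpl; ring.
Qed.

(** In tri (r+s) + tri (r-s) = 2 tri r + 2 tri s + s the cross terms cancel, so r and s separate.
    The factors 2 give the base p^2, and the extra s gives the p in p a / b. *)
Lemma theta_term_even_pair (p a b : C) (r s : Z) :
  p <> 0 -> a <> 0 -> b <> 0 ->
  theta_term p a (r + s) * theta_term p b (r - s)
  = theta_term (p ^ 2) (a * b) r * theta_term (p ^ 2) (p * a / b) s.
Proof.
intros Hp Ha Hb; unfold theta_term, Cdiv, Z.sub.
rewrite !zpow_sqr, !zpow_mul, !(zpow_add a), !(zpow_add b), zpow_opp, zpow_inv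
  by auto using Cinv_neq_0, Cmult_neq_0.
transitivity (zpow p (tri (r + s) + tri (r + - s))
  * (zpow a r * zpow a s * zpow b r * / zpow b s));
  [rewrite zpow_add by exact Hp; ring|].
replace (tri (r + s) + tri (r + - s))%Z with (2 * tri r + (2 * tri s + s))%Z.
- rewrite !zpow_add by exact Hp; ring.
- pose proof (tri_double r); pose proof (tri_double s).
  pose proof (tri_double (r + s)); pose proof (tri_double (r + - s)); lia.
Qed.

(** Here tri (r+s) + tri (r-s+1) = 2 tri r + r + 2 tri s, so the extra p goes to the series in r,
    and the shift by 1 leaves the factor b. *)
Lemma theta_term_odd_pair (p a b : C) (r s : Z) :
  p <> 0 -> a <> 0 -> b <> 0 ->
  theta_term p a (r + s) * theta_term p b (r - s + 1)
  = (b * theta_term (p ^ 2) (p * a * b) r) * theta_term (p ^ 2) (a / b) s.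
Proof.
intros Hp Ha Hb; unfold theta_term, Cdiv, Z.sub.
rewrite !zpow_sqr, !zpow_mul, !(zpow_add a), (zpow_succ b), !(zpow_add b),
  zpow_opp, zpow_inv by auto using Cinv_neq_0, Cmult_neq_0.
transitivity (zpow p (tri (r + s) + tri (r + - s + 1))
  * (zpow a r * zpow a s * (b * (zpow b r * / zpow b s))));
  [rewrite zpow_add by exact Hp; ring|].
replace (tri (r + s) + tri (r + - s + 1))%Z
  with (2 * tri r + r + 2 * tri s)%Z.
- rewrite !zpow_add by exact Hp; ring.
- pose proof (tri_double r); pose proof (tri_double s).
  pose proof (tri_double (r + s)); pose proof (tri_double (r + - s + 1)); lia.
Qed.

Theorem theta_mul (p a b : C) :
  p <> 0 -> a <> 0 -> b <> 0 -> (Cmod p < 1)%R ->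
  zsum (theta_term p a) * zsum (theta_term p b)
  = zsum (theta_term (p ^ 2) (a * b)) * zsum (theta_term (p ^ 2) (p * a / b))
    + b * zsum (theta_term (p ^ 2) (p * a * b))
      * zsum (theta_term (p ^ 2) (a / b)).
Proof.
intros Hp Ha Hb Hp1.
assert (Habs : forall c : C, c <> 0 -> zabs (theta_term p c))
  by (intros c Hc; now apply zabs_theta_term).
assert (Habs2 : forall c : C, c <> 0 -> zabs (theta_term (p ^ 2) c)).
{ intros c Hc; apply zabs_theta_term;
    [now apply Cpow_nz|exact Hc|now apply Cmod_pow2_lt]. }
assert (Hb' := Cinv_neq_0 b Hb).
apply clim_unique with (fun N => csum (zfold (theta_term p a)) (S N)
                                 * csum (zfold (theta_term p b)) (S N)).
{ apply (clim_subseq (fun n => csum (zfold (theta_term p a)) n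
                               * csum (zfold (theta_term p b)) n) _ S); [lia|].
  apply clim_mult; apply zsum_lim; auto. }
apply clim_ext with (fun N =>
  csum (fun k => zfold (theta_term (p ^ 2) (a * b)) k
    * csum (zfold (theta_term (p ^ 2) (p * a / b))) (S N - k)) (S N)
  + csum (fun k => b * lsum (theta_term (p ^ 2) (p * a * b)) (low_shell k)
    * csum (fun j => lsum (theta_term (p ^ 2) (a / b)) (high_shell j))
        (N - k)) N).
{ intros N; rewrite <- square_sum, (lsum_perm _ _ _ (square_diamonds N)).
  rewrite lsum_app; f_equal.
  - rewrite (lsum_diamond _ _ _ _ _ (theta_term (p ^ 2) (a * b))
               (theta_term (p ^ 2) (p * a / b))).
    + apply csum_ext; intros k _; rewrite lsum_sym_shell; f_equal.
      apply csum_ext; intros j _; now rewrite lsum_sym_shell.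
    + intros r s; simpl; now apply theta_term_even_pair.
  - rewrite (lsum_diamond _ _ _ _ _
               (fun r => b * theta_term (p ^ 2) (p * a * b) r)
               (theta_term (p ^ 2) (a / b))).
    + apply csum_ext; intros k _; now rewrite lsum_scal.
    + intros r s; simpl; now apply theta_term_odd_pair. }
apply clim_plus.
- apply (clim_subseq (fun n =>
    csum (fun k => zfold (theta_term (p ^ 2) (a * b)) k
      * csum (zfold (theta_term (p ^ 2) (p * a / b))) (n - k)) n) _ S); [lia|].
  apply clim_cauchy_product.
  + apply zabs_zfold, Habs2, Cmult_neq_0; assumption.
  + apply zsum_lim, Habs2, Cmult_neq_0; assumption.
  + apply zsum_lim, Habs2; repeat apply Cmult_neq_0; assumption.
- apply clim_ext with (fun N => b *
    csum (fun k => lsum (theta_term (p ^ 2) (p * a * b)) (low_shell k)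
      * csum (fun j => lsum (theta_term (p ^ 2) (a / b)) (high_shell j))
          (N - k)) N).
  { intros N; rewrite <- csum_scal; apply csum_ext; intros; ring. }
  rewrite <- (Cmult_assoc b (zsum _)).
  apply clim_scal, clim_cauchy_product.
  + apply ex_series_low_shell, Habs2; repeat apply Cmult_neq_0; assumption.
  + apply zsum_low_shell, Habs2; repeat apply Cmult_neq_0; assumption.
  + apply zsum_high_shell, Habs2, Cmult_neq_0; assumption.
Qed.

(** * The Weierstrass three-term relation *)

Lemma qtheta_inv (a p : C) :
  (Cmod p < 1)%R -> a <> 0 -> qtheta (/ a) p = - qtheta a p / a.
Proof.
intros Hp1 Ha; unfold qtheta.
rewrite (qpoch_shift (/ a) p), (qpoch_shift a p) by exact Hp1.
replace (/ a * p) with (p / a) by (field; exact Ha).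
replace (p / / a) with (a * p) by (field; exact Ha).
field; exact Ha.
Qed.

Lemma qtheta_refl (a b p : C) : a * b = p -> p <> 0 -> qtheta a p = qtheta b p.
Proof.
intros E Hp.
assert (Ha : a <> 0) by (intros H; apply Hp; rewrite <- E, H; ring).
assert (Hb : b <> 0) by (intros H; apply Hp; rewrite <- E, H; ring).
unfold qtheta; rewrite <- E.
replace (a * b / a) with b by (field; exact Ha).
replace (a * b / b) with a by (field; exact Hb).
ring.
Qed.

(* Each product of two theta functions below is
   [A(X) B(Y) - b B(X) A(Y)] for the same functions [A] and [B], so that the
   identity is a Pluecker relation. *)
Theorem weierstrass_three_term (p a b g h : C) :
  (Cmod p < 1)%R -> p <> 0 -> a <> 0 -> b <> 0 -> g <> 0 -> h <> 0 ->
  qtheta a p * qtheta b p * qtheta (a * g * h) p * qtheta (b * h / g) p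
  - qtheta (a * g) p * qtheta (b / g) p * qtheta (a * h) p * qtheta (b * h) p
  = b / g * qtheta (a * g / b) p * qtheta g p
    * qtheta (a * b * h) p * qtheta h p.
Proof.
intros Hp1 Hp Ha Hb Hg Hh.
assert (HP : qpoch p p <> 0) by now apply qpoch_neq_0.
set (A := fun x => zsum (theta_term (p ^ 2) x)).
set (B := fun x => zsum (theta_term (p ^ 2) (p * x))).
assert (H : forall x y : C, x <> 0 -> y <> 0 ->
  qpoch p p ^ 2 * (qtheta x p * qtheta y p)
  = A (x * y) * B (x / y) - y * B (x * y) * A (x / y)).
{ intros x y Hx Hy.
  replace (qpoch p p ^ 2 * (qtheta x p * qtheta y p))
    with ((qpoch p p * qtheta x p) * (qpoch p p * qtheta y p)) by ring.
  rewrite !jacobi_triple_product, theta_mul by auto using Copp_neq_0.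
  unfold A, B.
  replace (- x * - y) with (x * y) by ring.
  replace (p * - x * - y) with (p * (x * y)) by ring.
  replace (- x / - y) with (x / y) by (field; auto using Copp_neq_0).
  replace (p * - x / - y) with (p * (x / y))
    by (field; auto using Copp_neq_0).
  ring. }
assert (Hg' := Cinv_neq_0 g Hg); assert (Hh' := Cinv_neq_0 h Hh).
assert (Hb' := Cinv_neq_0 b Hb).
(* The four points of the Pluecker relation. The six products of two thetas realise its six pairs:
   XY, UV, XV, UY, YV and XU. The last two need the arguments 1/g and 1/h, which [qtheta_inv]
   converts to g and h. *)
pose (X := a * b); pose (Y := a / b).
pose (U := a * b * h ^ 2); pose (V := a * g ^ 2 / b).
assert (H' : forall x y z w : C, x <> 0 -> y <> 0 -> x * y = z -> x / y = w ->
  qpoch p p ^ 2 * (qtheta x p * qtheta y p) = A z * B w - y * B z * A w)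
  by (intros x y z w Hx Hy <- <-; now apply H).
assert (E1 := H' a b X Y Ha Hb eq_refl eq_refl).
assert (E2 := H' (a * g * h) (b * h / g) U V).
assert (E3 := H' (a * g) (b / g) X V).
assert (E4 := H' (a * h) (b * h) U Y).
assert (E5 := H' (a * g / b) (/ g) Y V).
assert (E6 := H' (a * b * h) (/ h) X U).
unfold X, Y, U, V, Cdiv in E2, E3, E4, E5, E6.
specialize (E2 ltac:(repeat apply Cmult_neq_0; assumption)
  ltac:(repeat apply Cmult_neq_0; assumption)
  ltac:(field; auto) ltac:(field; auto)).
specialize (E3 ltac:(repeat apply Cmult_neq_0; assumption)
  ltac:(repeat apply Cmult_neq_0; assumption)
  ltac:(field; auto) ltac:(field; auto)).
specialize (E4 ltac:(repeat apply Cmult_neq_0; assumption)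
  ltac:(repeat apply Cmult_neq_0; assumption)
  ltac:(field; auto) ltac:(field; auto)).
specialize (E5 ltac:(repeat apply Cmult_neq_0; assumption)
  ltac:(repeat apply Cmult_neq_0; assumption)
  ltac:(field; auto) ltac:(field; auto)).
specialize (E6 ltac:(repeat apply Cmult_neq_0; assumption)
  ltac:(repeat apply Cmult_neq_0; assumption)
  ltac:(field; auto) ltac:(field; auto)).
replace (b / g * qtheta (a * g / b) p * qtheta g p
    * qtheta (a * b * h) p * qtheta h p)
  with (b * h * (qtheta (a * g / b) p * qtheta (/ g) p)
        * (qtheta (a * b * h) p * qtheta (/ h) p)).
2: { rewrite !qtheta_inv by assumption; field; auto. }
assert (Hcancel : forall x y : C,
  qpoch p p ^ 4 * x = qpoch p p ^ 4 * y -> x = y).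
{ intros x y E.
  replace x with (/ qpoch p p ^ 4 * (qpoch p p ^ 4 * x)) by (field; exact HP).
  rewrite E; field; exact HP. }
apply Hcancel.
transitivity (
  (qpoch p p ^ 2 * (qtheta a p * qtheta b p))
  * (qpoch p p ^ 2 * (qtheta (a * g * h) p * qtheta (b * h * / g) p))
  - (qpoch p p ^ 2 * (qtheta (a * g) p * qtheta (b * / g) p))
  * (qpoch p p ^ 2 * (qtheta (a * h) p * qtheta (b * h) p))).
{ unfold Cdiv; ring. }
transitivity (b * h *
  (qpoch p p ^ 2 * (qtheta (a * g * / b) p * qtheta (/ g) p))
  * (qpoch p p ^ 2 * (qtheta (a * b * h) p * qtheta (/ h) p))).
2: { unfold Cdiv; ring. }
rewrite E1, E2, E3, E4, E5, E6; unfold X, Y, U, V, Cdiv.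
field; auto.
Qed.

(** * Relations between R(q), R(q^2) and R(q^4) *)

Lemma Cminus_eq_0 (x y : C) : x - y = 0 -> x = y.
Proof.
intros H; replace x with (x - y + y) by ring; rewrite H; ring.
Qed.

Lemma qtheta_dissect (a p : C) :
  (Cmod p < 1)%R -> a <> 0 -> p <> 0 ->
  qtheta a p = qtheta a (p ^ 2) * qtheta (a * p) (p ^ 2).
Proof.
intros Hp1 Ha Hp; unfold qtheta.
rewrite (qpoch_dissect a p), (qpoch_dissect (p / a) p) by exact Hp1.
replace (p / a * p) with (p ^ 2 / a) by (field; exact Ha).
replace (p ^ 2 / (a * p)) with (p / a) by (field; auto).
ring.
Qed.

Lemma qtheta_sqr (a p : C) :
  (Cmod p < 1)%R -> a <> 0 ->
  qtheta a p * qtheta (- a) p = qtheta (a ^ 2) (p ^ 2).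
Proof.
intros Hp1 Ha; unfold qtheta.
replace (p / - a) with (- (p / a)) by (field; auto using Copp_neq_0).
rewrite <- (qpoch_sqr a p) by exact Hp1.
replace (p ^ 2 / a ^ 2) with ((p / a) ^ 2) by (field; exact Ha).
rewrite <- qpoch_sqr by exact Hp1; ring.
Qed.

Lemma Cmod_pow_lt_1 (q : C) (n : nat) :
  (Cmod q < 1)%R -> (0 < n)%nat -> (Cmod (q ^ n) < 1)%R.
Proof.
intros Hq Hn; destruct n as [|n]; [lia|].
rewrite Cpow_S; now apply Cmod_mul_pow_lt.
Qed.

(* [th q n k] is [(q^k, q^(n-k); q^n)_oo] for [0 < k < n], and [tn] is its
   companion at [- q^k]. *)
Definition th (q : C) (n k : nat) : C := qtheta (q ^ k) (q ^ n).

Definition tn (q : C) (n k : nat) : C := qtheta (- q ^ k) (q ^ n).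

Section Products.

Variable q : C.
Hypothesis q_neq_0 : q <> 0.
Hypothesis q_lt_1 : (Cmod q < 1)%R.

Lemma th_refl (n k j : nat) : (k + j = n)%nat -> th q n k = th q n j.
Proof.
intros <-; apply qtheta_refl; [now rewrite Cpow_add_r|now apply Cpow_nz].
Qed.

Lemma tn_refl (n k j : nat) : (k + j = n)%nat -> tn q n k = tn q n j.
Proof.
intros <-; apply qtheta_refl; [rewrite Cpow_add_r; ring|now apply Cpow_nz].
Qed.

Lemma th_dissect (n k : nat) :
  (k < n)%nat -> th q n k = th q (2 * n) k * th q (2 * n) (n - k).
Proof.
intros Hk; rewrite (th_refl (2 * n) (n - k) (k + n)) by lia.
unfold th; rewrite qtheta_dissect.
- now rewrite Cpow_add_r, Nat.mul_comm, Cpow_mult_r.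
- apply Cmod_pow_lt_1; [exact q_lt_1|lia].
- now apply Cpow_nz.
- now apply Cpow_nz.
Qed.

Lemma th_tn (n k : nat) :
  (0 < n)%nat -> th q n k * tn q n k = th q (2 * n) (2 * k).
Proof.
intros Hn; unfold th, tn; rewrite qtheta_sqr.
- now rewrite !(Nat.mul_comm 2), !Cpow_mult_r.
- now apply Cmod_pow_lt_1.
- now apply Cpow_nz.
Qed.

Lemma th_neq_0 (n k : nat) : (0 < k < n)%nat -> th q n k <> 0.
Proof.
intros Hk; apply Cmult_neq_0; apply qpoch_neq_0.
- apply Cmod_pow_lt_1; [exact q_lt_1|lia].
- apply Cmod_pow_lt_1; [exact q_lt_1|lia].
- apply Cmod_pow_lt_1; [exact q_lt_1|lia].
- replace (q ^ n / q ^ k) with (q ^ (n - k)).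
  + apply Cmod_pow_lt_1; [exact q_lt_1|lia].
  + replace n with (n - k + k)%nat at 2 by lia.
    rewrite Cpow_add_r; field; now apply Cpow_nz.
Qed.

Lemma RRm_th (m : nat) :
  (0 < m)%nat -> RRm q m = th q (5 * m) m / th q (5 * m) (2 * m).
Proof.
intros Hm; unfold RRm, RR, th, qtheta.
assert (Hm0 := Cpow_nz q m q_neq_0).
rewrite (Nat.mul_comm 5), (Nat.mul_comm 2), !Cpow_mult_r.
replace ((q ^ m) ^ 5 / q ^ m) with ((q ^ m) ^ 4) by (field; exact Hm0).
replace ((q ^ m) ^ 5 / (q ^ m) ^ 2) with ((q ^ m) ^ 3) by (field; exact Hm0).
reflexivity.
Qed.

(** Doubling the base q^5 puts R(q) over the same base as R(q^2). *)
Lemma RRm1_th10 :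
  RRm q 1 = th q 10 1 * th q 10 4 / (th q 10 2 * th q 10 3).
Proof.
rewrite RRm_th by lia; cbn [Nat.mul Nat.add].
now rewrite (th_dissect 5 1), (th_dissect 5 2) by lia.
Qed.

Lemma RRm2_th10 : RRm q 2 = th q 10 2 / th q 10 4.
Proof. now rewrite RRm_th by lia. Qed.

Lemma RRm4_th20 : RRm q 4 = th q 20 4 / th q 20 8.
Proof. now rewrite RRm_th by lia. Qed.

Lemma weierstrass_pow (n : nat) (a b g h : C) :
  (0 < n)%nat -> a <> 0 -> b <> 0 -> g <> 0 -> h <> 0 ->
  qtheta a (q ^ n) * qtheta b (q ^ n)
    * qtheta (a * g * h) (q ^ n) * qtheta (b * h / g) (q ^ n)
  - qtheta (a * g) (q ^ n) * qtheta (b / g) (q ^ n)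
    * qtheta (a * h) (q ^ n) * qtheta (b * h) (q ^ n)
  = b / g * qtheta (a * g / b) (q ^ n) * qtheta g (q ^ n)
    * qtheta (a * b * h) (q ^ n) * qtheta h (q ^ n).
Proof.
intros; apply weierstrass_three_term; auto using Cpow_nz, Cmod_pow_lt_1.
Qed.

(** The bracket is [th q 10 3 * th q 10 4] times 1 + q u v^2. In the instance (a, b, g, h) = (q,
    q^2, q^3, q^2) the argument b / g is 1/q, and its inversion by [qtheta_inv] supplies the
    coefficient q. *)
Lemma th10_add :
  th q 10 1 * th q 10 4 * (th q 10 3 * th q 10 4 + q * (th q 10 1 * th q 10 2))
  = th q 10 2 ^ 2 * th q 10 3 * th q 10 5.
Proof.
assert (H := weierstrass_pow 10 (q ^ 1) (q ^ 2) (q ^ 3) (q ^ 2)).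
specialize (H ltac:(lia) ltac:(now apply Cpow_nz) ltac:(now apply Cpow_nz)
  ltac:(now apply Cpow_nz) ltac:(now apply Cpow_nz)).
replace (q ^ 1 * q ^ 3 * q ^ 2) with (q ^ 6) in H by ring.
replace (q ^ 2 * q ^ 2 / q ^ 3) with (q ^ 1) in H by (field; auto).
replace (q ^ 1 * q ^ 3) with (q ^ 4) in H by ring.
replace (q ^ 2 / q ^ 3) with (/ q ^ 1) in H by (field; auto).
replace (q ^ 1 * q ^ 2) with (q ^ 3) in H by ring.
replace (q ^ 2 * q ^ 2) with (q ^ 4) in H by ring.
replace (q ^ 4 / q ^ 2) with (q ^ 2) in H by (field; auto).
replace (q ^ 3 * q ^ 2) with (q ^ 5) in H by ring.
rewrite qtheta_inv in H;
  [|apply Cmod_pow_lt_1; [exact q_lt_1|lia]|now apply Cpow_nz].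
fold (th q 10 1) (th q 10 2) (th q 10 3) (th q 10 4) (th q 10 5) (th q 10 6)
  in H.
rewrite (th_refl 10 6 4) in H by lia.
transitivity (q * (th q 10 1 * th q 10 2 * th q 10 4 * th q 10 1
  - th q 10 4 * (- th q 10 1 / q ^ 1) * th q 10 3 * th q 10 4)).
- field; exact q_neq_0.
- rewrite H; field; exact q_neq_0.
Qed.

(** Replacing g = q^3 by -q^3 in the instance of [th10_add] changes the sign in the bracket, at the
    price of thetas at negative arguments, which must then be eliminated. *)
Lemma th10_sub :
  th q 10 2 * th q 10 3 * (th q 10 3 * th q 10 4 - q * (th q 10 1 * th q 10 2))
  = th q 10 1 * th q 10 4 ^ 2 * th q 10 5.
Proof.
assert (H := weierstrass_pow 10 (q ^ 1) (q ^ 2) (- q ^ 3) (q ^ 2)).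
specialize (H ltac:(lia) ltac:(now apply Cpow_nz) ltac:(now apply Cpow_nz)
  ltac:(now apply Copp_neq_0, Cpow_nz) ltac:(now apply Cpow_nz)).
replace (q ^ 1 * - q ^ 3 * q ^ 2) with (- q ^ 6) in H by ring.
replace (q ^ 2 * q ^ 2 / - q ^ 3) with (- q ^ 1) in H
  by (field; auto using Copp_neq_0).
replace (q ^ 1 * - q ^ 3) with (- q ^ 4) in H by ring.
replace (q ^ 2 / - q ^ 3) with (/ - q ^ 1) in H
  by (field; auto using Copp_neq_0).
replace (q ^ 1 * q ^ 2) with (q ^ 3) in H by ring.
replace (q ^ 2 * q ^ 2) with (q ^ 4) in H by ring.
replace (- q ^ 4 / q ^ 2) with (- q ^ 2) in H by (field; auto).
replace (q ^ 3 * q ^ 2) with (q ^ 5) in H by ring.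
rewrite qtheta_inv in H;
  [|apply Cmod_pow_lt_1; [exact q_lt_1|lia]
   |now apply Copp_neq_0, Cpow_nz].
fold (th q 10 1) (th q 10 2) (th q 10 3) (th q 10 4) (th q 10 5) in H.
fold (tn q 10 1) (tn q 10 2) (tn q 10 3) (tn q 10 4) (tn q 10 6) in H.
rewrite (tn_refl 10 6 4) in H by lia.
assert (Hsub : tn q 10 1 * tn q 10 4
    * (th q 10 3 * th q 10 4 - q * (th q 10 1 * th q 10 2))
  = tn q 10 2 * tn q 10 3 * th q 10 5 * th q 10 2).
{ transitivity (- q * (th q 10 1 * th q 10 2 * tn q 10 4 * tn q 10 1
    - tn q 10 4 * (- tn q 10 1 / - q ^ 1) * th q 10 3 * th q 10 4)).
  - field; auto using Copp_neq_0.
  - rewrite H; field; auto using Copp_neq_0. }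
(* Squaring the arguments gives thetas at base q^20, which recombine in pairs to base q^10.
   Multiplying by [th q 10 2] in the form of [H14] creates the factor that [Hsub] needs; [H23] then
   removes the remaining [tn]. *)
assert (H14 : th q 10 1 * tn q 10 1 * (th q 10 4 * tn q 10 4) = th q 10 2).
{ rewrite !th_tn, (th_dissect 10 2) by lia; reflexivity. }
assert (H23 : th q 10 2 * tn q 10 2 * (th q 10 3 * tn q 10 3) = th q 10 4).
{ rewrite !th_tn, (th_dissect 10 4) by lia; reflexivity. }
assert (H2 : th q 10 2 <> 0) by (apply th_neq_0; lia).
transitivity (/ th q 10 2 * (th q 10 2 * th q 10 3
  * (th q 10 1 * th q 10 4) * (tn q 10 1 * tn q 10 4
     * (th q 10 3 * th q 10 4 - q * (th q 10 1 * th q 10 2))))).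
- transitivity (/ th q 10 2 * (th q 10 2 * th q 10 3
    * (th q 10 1 * tn q 10 1 * (th q 10 4 * tn q 10 4))
    * (th q 10 3 * th q 10 4 - q * (th q 10 1 * th q 10 2)))).
  + rewrite H14; field; exact H2.
  + ring.
- rewrite Hsub.
  transitivity (/ th q 10 2 * (th q 10 1 * th q 10 4 * th q 10 5 * th q 10 2
    * (th q 10 2 * tn q 10 2 * (th q 10 3 * tn q 10 3)))).
  + ring.
  + rewrite H23; field; exact H2.
Qed.

(** Since u v = [th q 10 1 / th q 10 3], dissection to base q^20 makes the left side a multiple of u
    v + q w^2. Taking a = b = h = q^4 produces the squares. *)
Lemma th20_add :
  th q 20 1 * th q 20 9 * th q 20 8 ^ 2
  + q * (th q 20 3 * th q 20 7 * th q 20 4 ^ 2)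
  = th q 20 4 * th q 20 5 ^ 2 * th q 20 8.
Proof.
assert (H := weierstrass_pow 20 (q ^ 4) (q ^ 4) (q ^ 5) (q ^ 4)).
specialize (H ltac:(lia) ltac:(now apply Cpow_nz) ltac:(now apply Cpow_nz)
  ltac:(now apply Cpow_nz) ltac:(now apply Cpow_nz)).
replace (q ^ 4 * q ^ 5 * q ^ 4) with (q ^ 13) in H by ring.
replace (q ^ 4 * q ^ 4 / q ^ 5) with (q ^ 3) in H by (field; auto).
replace (q ^ 4 * q ^ 5 / q ^ 4) with (q ^ 5) in H by (field; auto).
replace (q ^ 4 * q ^ 5) with (q ^ 9) in H by ring.
replace (q ^ 4 / q ^ 5) with (/ q ^ 1) in H by (field; auto).
replace (q ^ 4 * q ^ 4 * q ^ 4) with (q ^ 12) in H by ring.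
replace (q ^ 4 * q ^ 4) with (q ^ 8) in H by ring.
rewrite qtheta_inv in H;
  [|apply Cmod_pow_lt_1; [exact q_lt_1|lia]|now apply Cpow_nz].
fold (th q 20 1) (th q 20 3) (th q 20 4) (th q 20 5) (th q 20 8) (th q 20 9)
  (th q 20 12) (th q 20 13) in H.
rewrite (th_refl 20 13 7), (th_refl 20 12 8) in H by lia.
transitivity (q * (th q 20 4 * th q 20 4 * th q 20 7 * th q 20 3
  - th q 20 9 * (- th q 20 1 / q ^ 1) * th q 20 8 * th q 20 8)).
- field; exact q_neq_0.
- rewrite H; field; exact q_neq_0.
Qed.

Lemma rogers_relation :
  RRm q 2 - RRm q 1 ^ 2
  = q * RRm q 1 * RRm q 2 ^ 2 * (RRm q 2 + RRm q 1 ^ 2).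
Proof.
assert (N2 : th q 10 2 <> 0) by (apply th_neq_0; lia).
assert (N3 : th q 10 3 <> 0) by (apply th_neq_0; lia).
assert (N4 : th q 10 4 <> 0) by (apply th_neq_0; lia).
rewrite RRm1_th10, RRm2_th10.
apply Cminus_eq_0.
transitivity ((th q 10 2 ^ 2 * th q 10 3 * (th q 10 2 * th q 10 3
      * (th q 10 3 * th q 10 4 - q * (th q 10 1 * th q 10 2)))
    - th q 10 1 * th q 10 4 ^ 2 * (th q 10 1 * th q 10 4
      * (th q 10 3 * th q 10 4 + q * (th q 10 1 * th q 10 2))))
  / (th q 10 2 ^ 2 * th q 10 3 ^ 3 * th q 10 4 ^ 2)).
- field; auto.
- rewrite th10_add, th10_sub; field; auto.
Qed.

(** Both u v + q w^2 and 1 + q u v^2 are theta quotients, by [th20_add] and [th10_add]; at base q^20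
    all factors cancel. *)
Lemma rogers_relation_mixed :
  RRm q 2 * (RRm q 1 * RRm q 2 + q * RRm q 4 ^ 2)
  = RRm q 1 * RRm q 4 * (1 + q * RRm q 1 * RRm q 2 ^ 2).
Proof.
assert (N : forall k, (0 < k < 20)%nat -> th q 20 k <> 0)
  by (intros; now apply th_neq_0).
assert (N10 : forall k, (0 < k < 10)%nat -> th q 10 k <> 0)
  by (intros; now apply th_neq_0).
assert (E1 : 1 + q * RRm q 1 * RRm q 2 ^ 2
  = th q 10 2 ^ 2 * th q 10 5 / (th q 10 1 * th q 10 4 ^ 2)).
{ transitivity (th q 10 1 * th q 10 4
    * (th q 10 3 * th q 10 4 + q * (th q 10 1 * th q 10 2))
    / (th q 10 1 * th q 10 3 * th q 10 4 ^ 2)).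
  - rewrite RRm1_th10, RRm2_th10; field; repeat split; apply N10; lia.
  - rewrite th10_add; field; repeat split; apply N10; lia. }
assert (D : forall k, (k < 10)%nat -> th q 10 k = th q 20 k * th q 20 (10 - k))
  by (intros; now apply th_dissect).
assert (E2 : RRm q 1 * RRm q 2 + q * RRm q 4 ^ 2
  = th q 20 4 * th q 20 5 ^ 2 / (th q 20 3 * th q 20 7 * th q 20 8)).
{ transitivity ((th q 20 1 * th q 20 9 * th q 20 8 ^ 2
      + q * (th q 20 3 * th q 20 7 * th q 20 4 ^ 2))
    / (th q 20 3 * th q 20 7 * th q 20 8 ^ 2)).
  - rewrite RRm1_th10, RRm2_th10, RRm4_th20, !D by lia; cbn [Nat.sub].
    field; repeat split; apply N; lia.
  - rewrite th20_add; field; repeat split; apply N; lia. }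
rewrite E1, E2, RRm1_th10, RRm2_th10, RRm4_th20, !D by lia; cbn [Nat.sub].
field; repeat split; apply N; lia.
Qed.

Lemma RRm_neq_0 (m : nat) : (0 < m)%nat -> RRm q m <> 0.
Proof.
intros Hm; rewrite RRm_th by exact Hm; apply Cmult_neq_0.
- apply th_neq_0; lia.
- apply Cinv_neq_0, th_neq_0; lia.
Qed.

(** Subtract u times the mixed relation from w times Rogers' relation: the terms in u^2 w and q u^3
    v^2 w cancel, and the rest is divisible by v. *)
Lemma rogers_relation_quartic :
  RRm q 4 - RRm q 1 ^ 2 * RRm q 2
  = q * RRm q 1 * RRm q 4 * (RRm q 4 + RRm q 2 ^ 2).
Proof.
assert (N2 := RRm_neq_0 2 ltac:(lia)).
assert (E := rogers_relation); assert (E' := rogers_relation_mixed).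
apply Cminus_eq_0.
transitivity ((RRm q 4 * (RRm q 2 - RRm q 1 ^ 2
      - q * RRm q 1 * RRm q 2 ^ 2 * (RRm q 2 + RRm q 1 ^ 2))
    - RRm q 1 * (RRm q 2 * (RRm q 1 * RRm q 2 + q * RRm q 4 ^ 2)
      - RRm q 1 * RRm q 4 * (1 + q * RRm q 1 * RRm q 2 ^ 2))) / RRm q 2).
- field; exact N2.
- rewrite E, E'; field; exact N2.
Qed.

End Products.

(** * Elimination leading to the two identities *)

Lemma RRm_pow (q : C) (k m : nat) : RRm (q ^ k) m = RRm q (k * m).
Proof. unfold RRm; now rewrite Cpow_mult_r. Qed.

Lemma Cdiv_eq (x y z : C) : x = z * y -> y <> 0 -> x / y = z.
Proof. intros -> Hy; field; exact Hy. Qed.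

(* For isolated q the numerator and the denominator of a left-hand side vanish
   together (for the first one near q = 0.476043 + 0.668892 i), so each identity
   is stated as an equality of quotients where the denominator is nonzero, and
   in cleared form for every q. *)
Theorem theorem1p2 (q : C) (hq : (0 < Cmod q < 1)%R) :
  let R1 := RRm q 1 in
  let R2 := RRm q 2 in
  let R4 := RRm q 4 in
  let R8 := RRm q 8 in
  let R16 := RRm q 16 in
  let N1 := (R2 - R1 ^ 2) * (R8 - R1 ^ 2 * R2 * R4) in
  let D1 := (R2 - R1 ^ 2) * (R8 + R4 ^ 2) + R2 ^ 3 * (R2 + R1 ^ 2) ^ 2 in
  let N2 := (R2 - R1 ^ 2) ^ 3 * (R4 - R2 ^ 2)
            * (R16 - R1 ^ 2 * R2 * R4 * R8) in
  let D2 := (R2 - R1 ^ 2) ^ 3 * (R4 - R2 ^ 2) * (R16 + R8 ^ 2)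
            + Qpoly R1 R2 R4 in
  ((D1 <> 0 -> N1 / D1 = q ^ 2 * R1 ^ 2 * R8)
   /\ N1 = q ^ 2 * R1 ^ 2 * R8 * D1)
  /\
  ((D2 <> 0 -> N2 / D2 = q ^ 4 * R1 ^ 2 * R2 * R16)
   /\ N2 = q ^ 4 * R1 ^ 2 * R2 * R16 * D2).
Proof.
intros R1 R2 R4 R8 R16 N1 D1 N2 D2.
assert (Hq0 : q <> 0) by (apply Cmod_gt_0; lra).
assert (Hq1 : (Cmod q < 1)%R) by lra.
assert (P2 : R2 <> 0) by (apply RRm_neq_0; auto; lia).
assert (P4 : R4 <> 0) by (apply RRm_neq_0; auto; lia).
assert (L2 : (Cmod (q ^ 2) < 1)%R) by now apply Cmod_pow2_lt.
assert (L4 : (Cmod (q ^ 4) < 1)%R) by (apply Cmod_pow_lt_1; [exact Hq1|lia]).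
assert (S1 : R2 - R1 ^ 2 = q * R1 * R2 ^ 2 * (R2 + R1 ^ 2))
  by exact (rogers_relation q Hq0 Hq1).
assert (S2 : R4 - R2 ^ 2 = q ^ 2 * R2 * R4 ^ 2 * (R4 + R2 ^ 2)).
{ assert (H := rogers_relation (q ^ 2) (Cpow_nz _ _ Hq0) L2).
  repeat rewrite RRm_pow in H; exact H. }
assert (T2 : R8 - R2 ^ 2 * R4 = q ^ 2 * R2 * R8 * (R8 + R4 ^ 2)).
{ assert (H := rogers_relation_quartic (q ^ 2) (Cpow_nz _ _ Hq0) L2).
  repeat rewrite RRm_pow in H; exact H. }
assert (T4 : R16 - R4 ^ 2 * R8 = q ^ 4 * R4 * R16 * (R16 + R8 ^ 2)).
{ assert (H := rogers_relation_quartic (q ^ 4) (Cpow_nz _ _ Hq0) L4).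
  repeat rewrite RRm_pow in H; exact H. }
assert (F1 : N1 = q ^ 2 * R1 ^ 2 * R8 * D1).
{ unfold N1, D1; apply Cminus_eq_0.
  (* By the square of [S1], q^2 R1^2 R2^3 (R2 + R1^2)^2 equals (R2 - R1^2)^2 / R2. Substituting this
     cancels the product of R2 - R1^2 with R8, and what remains is a multiple of [T2]. *)
  transitivity (R1 ^ 2 * (R2 - R1 ^ 2) / R2 * ((R8 - R2 ^ 2 * R4)
      - q ^ 2 * R2 * R8 * (R8 + R4 ^ 2))
    + R8 / R2 * ((R2 - R1 ^ 2) ^ 2
      - (q * R1 * R2 ^ 2 * (R2 + R1 ^ 2)) ^ 2)).
  - field; exact P2.
  - rewrite T2, S1; field; exact P2. }
assert (F2 : N2 = q ^ 4 * R1 ^ 2 * R2 * R16 * D2).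
{ unfold N2, D2, Qpoly; apply Cminus_eq_0.
  (* The fourth power of [S1] and the square of [S2] rewrite q^4 R1^2 R2 Q as (R2 - R1^2)^3 (R4 -
     R2^2) times (R2 - R1^2)/R2 + R1^2 (R4 - R2^2)/(R2 R4). That sum telescopes to 1 - R1^2 R2 / R4,
     and what remains is a multiple of [T4]. *)
  transitivity (R1 ^ 2 * R2 / R4 * (R2 - R1 ^ 2) ^ 3 * (R4 - R2 ^ 2)
      * ((R16 - R4 ^ 2 * R8) - q ^ 4 * R4 * R16 * (R16 + R8 ^ 2))
    + R16 / R2 * (R4 - R2 ^ 2) * ((R2 - R1 ^ 2) ^ 4
      - (q * R1 * R2 ^ 2 * (R2 + R1 ^ 2)) ^ 4)
    + R1 ^ 2 * R16 / (R2 * R4) * (R2 - R1 ^ 2) ^ 3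
      * ((R4 - R2 ^ 2) ^ 2 - (q ^ 2 * R2 * R4 ^ 2 * (R4 + R2 ^ 2)) ^ 2)).
  - field; auto.
  - rewrite T4, <- S1, <- S2; field; auto. }
split; split; auto; now apply Cdiv_eq.
Qed.
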